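(* Let $0<\tau_1<1$ and $\delta>0$, let the fluid energy be $$U(\tau,c)=-(1-c)\log\frac{\tau-c\tau_1}{1-c}+W(c,\theta),\qquad \tau_1<\tau<\infty,\ 0<c<1,$$ and suppose that the mixing energy $W(\cdot,\theta)$ undergoes, with critical parameter values $c_*\in(0,1)$ and $\theta_*\in\mathbb{R}$, a generic transition at $c=c_*$ from convex for $\theta>\theta_*$ to convex-concave-convex (double-well) for $\theta<\theta_*$, in the sense specified in the context. Let $p(\rho,c)=-U_\tau(1/\rho,c)$ and $q(\rho,c)=-U_c(1/\rho,c)$ (the dependence of $q$ on $\theta$ being suppressed), and consider the Navier-Stokes-Allen-Cahn system given in the context. Then there is $\tilde\theta<\theta_*$ (sufficiently close to $\theta_*$) such that the following holds for every $\theta\in(\tilde\theta,\theta_*]$. There are locally uniquely determined fluid states $(\underline\rho_0,\underline c_0)$ and $(\overline\rho_0,\overline c_0)$, depending continuously on $\theta$, such that: (i) $q(\underline\rho_0,\underline c_0)=q(\overline\rho_0,\overline c_0)=0$ and $p(\underline\rho_0,\underline c_0)=p(\overline\rho_0,\overline c_0)$, with $(\underline\rho_0,\underline c_0)=(\overline\rho_0,\overline c_0)$ if $\theta=\theta_*$; and (ii) if $\theta<\theta_*$, then $\underline\rho_0<\overline\rho_0$, and the system admits a no-flux ($m=0$) phase boundary $(\overrightarrow\rho(x),0,\overrightarrow c(x))$ with $$(\overrightarrow\rho(-\infty),\overrightarrow c(-\infty))=(\underline\rho_0,\underline c_0),\qquad (\overrightarrow\rho(\infty),\overrightarrow c(\infty))=(\overline\rho_0,\overline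 c_0),$$ and (equivalently, via $x\mapsto -x$) a no-flux phase boundary $(\overleftarrow\rho(x),0,\overleftarrow c(x))$ with $$(\overleftarrow\rho(-\infty),\overleftarrow c(-\infty))=(\overline\rho_0,\overline c_0),\qquad (\overleftarrow\rho(\infty),\overleftarrow c(\infty))=(\underline\rho_0,\underline c_0).$$
   Context: **System.** The Navier-Stokes-Allen-Cahn system for density $\rho>0$, velocity $\mathbf u$ and mass fraction $c\in(0,1)$, at constant temperature $\theta$ (a parameter), is $$\partial_t\rho+\nabla\cdot(\rho\mathbf u)=0,$$ $$\partial_t(\rho\mathbf u)+\nabla\cdot(\rho\mathbf u\otimes\mathbf u+p(\rho,c)\mathbf I)=\nabla\cdot\big(\mu(\nabla\mathbf u+(\nabla\mathbf u)^T)+(\lambda\nabla\cdot\mathbf u)\mathbf I-\delta\rho\nabla c\otimes\nabla c\big),$$ $$\partial_t(\rho c)+\nabla\cdot(\rho c\,\mathbf u)=\delta^{-1/2}\big(\rho q(\rho,c)+\nabla\cdot(\delta\rho\nabla c)\big).$$ Here $\rho=1/\tau$ with $\tau$ the specific volume, and $\mu,\lambda$ are the viscosity coefficients (constants with $\mu\ge0$, $2\mu+\lambda\ge0$; the inviscid case $\mu=\lambda=0$ is allowed). A fluid state is a pair $(\rho,c)$ with $\tau_1<1/\rho<\infty$, $0<c<1$. **Phase boundaries.** A planar phase boundary is a nonconstant traveling-wave solution depending on one spatial variable $x$ (with velocity in the $x$-direction) that has limits as $x\to\pm\infty$. By Galilean invariance it is taken to be stationary. Its mass flux is the constant $m=\rho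 u$. A no-flux phase boundary ($m=0$, hence $u\equiv0$) is thus a nonconstant smooth solution $(\rho(x),0,c(x))$, $x\in\mathbb R$, of $$\big(p(\rho,c)+\delta\rho (c')^2\big)'=0,\qquad \rho q(\rho,c)+(\delta\rho c')'=0,$$ with values in the set of fluid states and limits in that set as $x\to\pm\infty$. **Generic transition.** $W$ is a smooth function of $(c,\theta)$. For $\theta>\theta_*$, $W(\cdot,\theta)$ is convex. For $\theta<\theta_*$ it is convex-concave-convex. The transition occurs at $c=c_*$ and is nondegenerate: at $(c_*,\theta_* )$, $$W_{cc}=W_{ccc}=0,\qquad W_{cccc}>0,\qquad W_{cc\theta}>0.$$ The mixing energy is normalized so that $W_c(c_*,\theta_* )=0$. **Critical state.** The critical pressure $p_*$ is the unique solution $p\in(0,1)$ of $\tau_1p-\log p-1=0$. The critical fluid state is $(\rho_*,c_* )$ with $1/\rho_*=c_*\tau_1+(1-c_* )/p_*$. At $\theta=\theta_*$ it satisfies $p(\rho_*,c_* )=p_*$ and $q(\rho_*,c_* )=0$. **Local uniqueness.** ''Locally uniquely determined'' means: there is a neighbourhood $N$ of $(\rho_*,c_* )$ such that, for $\theta\in(\tilde\theta,\theta_* )$, the pair $(\underline\rho_0,\underline c_0),(\overline\rho_0,\overline c_0)$ is the only pair of states in $N$ with properties (i) and (ii). At $\theta=\theta_*$ the common state is $(\rho_*,c_* )$, the limit as $\theta\uparrow\theta_*$. *)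

(* Defs.v *)
(* Real analysis over Stdlib's R with Coquelicot; MathComp's ordinals and
   big operators are used only to index the space coordinates. *)
From mathcomp Require Import ssreflect ssrfun ssrbool eqtype ssrnat fintype bigop.
From Stdlib Require Import Reals.
From Coquelicot Require Import Coquelicot.

Set Implicit Arguments.
Unset Strict Implicit.
Unset Printing Implicit Defensive.

Local Open Scope R_scope.

Definition smooth (f : R -> R) : Prop :=
  forall (k : nat) (x : R), ex_derive_n f k x.

(* For an open [D] this is C^infinity on [D]: [ex_diff_n f k x y] asserts that
   all iterated partial derivatives of order at most [k] exist and are jointly
   continuous at [(x, y)]. *)
Definition smooth2_on (D : R -> R -> Prop) (f : R -> R -> R) : Prop :=
  forall (k : nat) (x y : R), D x y -> ex_diff_n f k x y.

Definition convex_on (I : R -> Prop) (f : R -> R) : Prop :=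
  forall x y t : R, I x -> I y -> 0 <= t <= 1 ->
    f (t * x + (1 - t) * y) <= t * f x + (1 - t) * f y.

Definition concave_on (I : R -> Prop) (f : R -> R) : Prop :=
  convex_on I (fun x => - f x).

Definition convex_concave_convex (f : R -> R) : Prop :=
  exists a b : R, 0 < a /\ a < b /\ b < 1 /\
    convex_on (fun c => 0 < c <= a) f /\
    concave_on (fun c => a <= c <= b) f /\
    convex_on (fun c => b <= c < 1) f.

(* [W c theta] is the mixing energy; the last field is a normalization. *)
Record generic_transition (W : R -> R -> R) (cs ths : R) : Prop := {
  gt_smooth : smooth2_on (fun c theta => 0 < c < 1) W;
  gt_convex : forall theta, ths < theta ->
    convex_on (fun c => 0 < c < 1) (fun c => W c theta);
  gt_double_well : forall theta, theta < ths ->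
    convex_concave_convex (fun c => W c theta);
  gt_W_cc : Derive_n (fun c => W c ths) 2 cs = 0;
  gt_W_ccc : Derive_n (fun c => W c ths) 3 cs = 0;
  gt_W_cccc : 0 < Derive_n (fun c => W c ths) 4 cs;
  gt_W_cctheta : 0 < Derive (fun theta => Derive_n (fun c => W c theta) 2 cs) ths;
  gt_W_c : Derive (fun c => W c ths) cs = 0
}.

Definition fluid_energy (tau1 : R) (W : R -> R -> R) (theta tau c : R) : R :=
  - (1 - c) * ln ((tau - c * tau1) / (1 - c)) + W c theta.

Definition pressure (U : R -> R -> R) (rho c : R) : R :=
  - Derive (fun tau => U tau c) (/ rho).

Definition reaction (U : R -> R -> R) (rho c : R) : R :=
  - Derive (fun c' => U (/ rho) c') c.

(* Fluid states are pairs (rho, c). *)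
Definition state : Type := (R * R)%type.

Definition fluid_state (tau1 : R) (s : state) : Prop :=
  0 < s.1 /\ tau1 < / s.1 /\ 0 < s.2 < 1.

Definition is_critical_pressure (tau1 ps : R) : Prop :=
  0 < ps < 1 /\ tau1 * ps - ln ps - 1 = 0.

Definition critical_state (tau1 cs ps : R) : state :=
  (/ (cs * tau1 + (1 - cs) / ps), cs).

Section System.

(* Space dimension n + 1 >= 1; a field is a function of time and position. *)
Variable n : nat.

Definition point : Type := 'I_n.+1 -> R.
Definition field : Type := R -> point -> R.

Definition dt (f : field) : field :=
  fun t X => Derive (fun s => f s X) t.

Definition dx (i : 'I_n.+1) (f : field) : field :=
  fun t X => Derive (fun z => f t (fun k => if k == i then z else X k)) (X i).

Definition dive (F : 'I_n.+1 -> field) : field :=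
  fun t X => \big[Rplus/0]_i dx i (F i) t X.

Definition kron (i j : 'I_n.+1) : R := if i == j then 1 else 0.

Definition NSAC (delta mu lambda : R) (p q : R -> R -> R)
    (rho : field) (u : 'I_n.+1 -> field) (c : field) : Prop :=
  forall (t : R) (X : point),
    dt rho t X + dive (fun i s Y => rho s Y * u i s Y) t X = 0
    /\
    (forall j : 'I_n.+1,
      dt (fun s Y => rho s Y * u j s Y) t X
      + dive (fun i s Y => rho s Y * u i s Y * u j s Y
                           + p (rho s Y) (c s Y) * kron i j) t X
      = dive (fun i s Y => mu * (dx i (u j) s Y + dx j (u i) s Y)
                           + lambda * dive u s Y * kron i j
                           - delta * rho s Y * dx i c s Y * dx j c s Y) t X)
    /\
    dt (fun s Y => rho s Y * c s Y) t X
    + dive (fun i s Y => rho s Y * c s Y * u i s Y) t X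
    = / sqrt delta
      * (rho t X * q (rho t X) (c t X)
         + dive (fun i s Y => delta * rho s Y * dx i c s Y) t X).

Definition planar (f : R -> R) : field := fun _ X => f (X ord0).

Definition planar_velocity (v : R -> R) (i : 'I_n.+1) : field :=
  if i == ord0 then planar v else (fun _ _ => 0).

(* Traveling waves are taken at rest (Galilean invariance), so they are
   stationary solutions. *)
Definition phase_boundary (tau1 delta mu lambda : R) (p q : R -> R -> R)
    (rho u c : R -> R) (sm sp : state) : Prop :=
  smooth rho /\ smooth u /\ smooth c /\
  (forall x, fluid_state tau1 (rho x, c x)) /\
  NSAC delta mu lambda p q (planar rho) (planar_velocity u) (planar c) /\
  (exists x y, (rho x, u x, c x) <> (rho y, u y, c y)) /\
  fluid_state tau1 sm /\ fluid_state tau1 sp /\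
  is_lim rho m_infty sm.1 /\ is_lim c m_infty sm.2 /\ ex_finite_lim u m_infty /\
  is_lim rho p_infty sp.1 /\ is_lim c p_infty sp.2 /\ ex_finite_lim u p_infty.

Definition no_flux_phase_boundary (tau1 delta mu lambda : R)
    (p q : R -> R -> R) (rho u c : R -> R) (sm sp : state) : Prop :=
  phase_boundary tau1 delta mu lambda p q rho u c sm sp /\
  forall x, rho x * u x = 0.

End System.

Section Properties.

Variables (n : nat) (tau1 delta mu lambda : R) (W : R -> R -> R) (theta : R).

Let p := pressure (fluid_energy tau1 W theta).
Let q := reaction (fluid_energy tau1 W theta).

Definition coexist (s1 s2 : state) : Prop :=
  q s1.1 s1.2 = 0 /\ q s2.1 s2.2 = 0 /\ p s1.1 s1.2 = p s2.1 s2.2.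

Definition connected (s1 s2 : state) : Prop :=
  s1.1 < s2.1 /\
  (exists rho c : R -> R,
    no_flux_phase_boundary n tau1 delta mu lambda p q rho (fun _ => 0) c s1 s2) /\
  (exists rho c : R -> R,
    no_flux_phase_boundary n tau1 delta mu lambda p q rho (fun _ => 0) c s2 s1).

End Properties.

(* Main.v *)
(* The pressure is p = (1 - c) / (tau - c tau1), and q = 0 reads
   W_c = - (tau1 p - ln p - 1). Multiplying the reaction equation by c' and using
   delta rho c'^2 = P - p gives the first integral U + (P + p) tau / 2. At rest
   points p = P, and there it equals, up to a constant depending on P,
   c (tau1 P - ln P - 1) + W(c): two rest points can be joined only if they are
   the contact points of a common tangent of W, whose slope - (tau1 P - ln P - 1)
   determines P.

   Near the critical point W_cccc > 0. Hence, by Hermite interpolation, W lies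
   strictly above any common tangent except at the contact points x < y; this
   gives the uniqueness of the tangent, and the positivity of the height G of W
   above it. For existence, the midpoint m and half-width r of the contact
   interval are found by two successive monotone scalar equations which remain
   regular at r = 0, so that the branch is continuous up to theta = ths.

   Conversely, for x < c < y the first integral is solved for p = P / u with u in
   [1, 3/2], which is possible because G is small. Then c' = Phi(c), with Phi
   positive on (x, y) and vanishing at least linearly at both ends, has an orbit
   from x to y. *)

Require Import Defs.
From mathcomp Require Import ssreflect ssrfun ssrbool eqtype ssrnat fintype bigop.
From Stdlib Require Import Reals Lra ClassicalEpsilon FunctionalExtensionality.
From Coquelicot Require Import Coquelicot.

Local Open Scope R_scope.

(** * Continuity of implicitly defined roots *)

(** Moreover [ths] and [r = 0] are endpoints of their ranges. Continuity is therefore stated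
    relative to a set, through [within], and roots are followed by a sign change together with
    uniqueness, with no condition on a derivative. Uniqueness of [r] is not read off from its
    equation but comes from geometry: two roots would give two common tangents.

    The normalization of [W] makes the tangent slope [0] at [ths], which is exactly the equation of
    the critical pressure; this is how the branch ends in the critical state.

    For local uniqueness the competitor is an arbitrary phase boundary, and nothing is assumed about
    [c'] at infinity. That [c'] tends to [0] has to be deduced from the convergence of [rho] and [c]
    before conserved quantities can be compared at the two ends. *)

Lemma clamp_within (a b y : R) : a <= b ->
  filterlim (fun t => Rmax a (Rmin b t)) (locally y)
    (within (fun t => a <= t <= b) (locally (Rmax a (Rmin b y)))).
Proof.
move=> ab P [e He]; exists e => t Ht; apply: He.
- move: Ht; rewrite /ball /= /AbsRing_ball /abs /minus /plus /opp /= => Ht.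
  apply: Rle_lt_trans Ht.
  rewrite /Rmax /Rmin.
  case: (Rle_dec b t) => ?; case: (Rle_dec b y) => ?; repeat case: Rle_dec => *;
  rewrite /Rabs; repeat case: Rcase_abs => *; lra.
- split; [exact: Rmax_l | apply: Rmax_lub => //; exact: Rmin_l].
Qed.

(** Precomposing with the clamp [Rmax a (Rmin b t)] turns continuity relative to the closed interval
    into continuity on the whole line, as [IVT_gen] wants it; nothing is assumed of [f] outside
    [[a, b]]. *)
Lemma IVT_within (f : R -> R) (a b : R) : a <= b ->
  (forall y, a <= y <= b ->
     filterlim f (within (fun t => a <= t <= b) (locally y)) (locally (f y))) ->
  f a <= 0 -> 0 <= f b -> exists y, a <= y <= b /\ f y = 0.
Proof.
move=> ab Hc fa fb.
pose h t := f (Rmax a (Rmin b t)).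
have inab t : a <= Rmax a (Rmin b t) <= b.
  by split; [exact: Rmax_l | apply: Rmax_lub => //; exact: Rmin_l].
have Ha : h a = f a by rewrite /h; congr f; rewrite Rmin_right // Rmax_left //; lra.
have Hb : h b = f b by rewrite /h; congr f; rewrite Rmin_left; [rewrite Rmax_right //|lra].
have [y [_ Hy]] : exists y, a <= y <= b /\ h y = 0.
  case: (IVT_gen h a b 0).
  - move=> t; apply/continuity_pt_filterlim.
    apply: filterlim_comp (clamp_within _ _ _ ab) _; exact: Hc.
  - rewrite Ha Hb; split; [apply: Rle_trans fa; exact: Rmin_l | apply: Rle_trans fb _; exact: Rmax_r].
  - move=> y [H1 H2]; exists y; split => //; move: H1; rewrite Rmin_left // Rmax_right //.
by exists (Rmax a (Rmin b y)).
Qed.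

(** Uniqueness forces [F z] to be negative before [phi z] and positive after it, since a wrong sign
    would produce a second root. The signs at the two fixed points [phi z - e] and [phi z + e]
    persist for nearby [z'] and trap [phi z'], so continuity in each variable separately is
    enough. *)
Lemma implicit_root (T : UniformSpace) (D : T -> Prop) (F : T -> R -> R) (a b : R) :
  a <= b ->
  (forall z y, D z -> a <= y <= b ->
     filterlim (F z) (within (fun t => a <= t <= b) (locally y)) (locally (F z y))) ->
  (forall z y, D z -> a <= y <= b ->
     filterlim (fun z' => F z' y) (within D (locally z)) (locally (F z y))) ->
  (forall z, D z -> F z a <= 0 <= F z b) ->
  (forall z y1 y2, D z -> a <= y1 -> y1 < y2 -> y2 <= b ->
     F z y1 = 0 -> F z y2 = 0 -> False) ->
  exists phi : T -> R, forall z, D z ->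
    a <= phi z <= b /\ F z (phi z) = 0 /\
    filterlim phi (within D (locally z)) (locally (phi z)).
Proof.
move=> ab Hy Hz Hab Huniq.
have Hex z : exists y, D z -> a <= y <= b /\ F z y = 0.
  case: (classic (D z)) => Dz; last by exists 0.
  have [y Py] := IVT_within (F z) a b ab (fun y => Hy z y Dz) (proj1 (Hab z Dz)) (proj2 (Hab z Dz)).
  by exists y.
pose phi z := proj1_sig (constructive_indefinite_description _ (Hex z)).
have Hphi z : D z -> a <= phi z <= b /\ F z (phi z) = 0.
  exact: proj2_sig (constructive_indefinite_description _ (Hex z)).
have neg z y : D z -> a <= y < phi z -> F z y < 0.
  move=> Dz [ay yp]; have [pab p0] := Hphi z Dz.
  case: (Rtotal_order (F z y) 0) => [//|[H0|Hpos]].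
    by exfalso; apply: (Huniq z y (phi z)) => //; lra.
  have [t [Ht Ht0]] : exists t, a <= t <= y /\ F z t = 0.
    apply: IVT_within => //; [|apply (Hab z Dz)|lra].
    move=> t Ht; apply: filterlim_filter_le_1 (Hy z t Dz _); last lra.
    move=> P [e He]; exists e => s Hs Hs2; apply: He => //; lra.
  exfalso; apply: (Huniq z t (phi z)) => //; lra.
have pos z y : D z -> phi z < y <= b -> 0 < F z y.
  move=> Dz [ay yp]; have [pab p0] := Hphi z Dz.
  case: (Rtotal_order (F z y) 0) => [Hneg|[H0|//]]; last first.
    by exfalso; apply: (Huniq z (phi z) y) => //; lra.
  have [t [Ht Ht0]] : exists t, y <= t <= b /\ F z t = 0.
    apply: IVT_within => //; [|lra|apply (Hab z Dz)].
    move=> t Ht; apply: filterlim_filter_le_1 (Hy z t Dz _); last lra.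
    move=> P [e He]; exists e => s Hs Hs2; apply: He => //; lra.
  exfalso; apply: (Huniq z (phi z) t) => //; lra.
exists phi => z Dz; have [pab p0] := Hphi z Dz; split => //; split => //.
apply/filterlim_locally => e.
have lowE : within D (locally z) (fun z' => phi z - e < phi z').
  case: (Rlt_dec (phi z - e) a) => Ha.
    by exists e => z' _ Dz'; have := Hphi z' Dz'; lra.
  have Hn : F z (phi z - e) < 0 by apply: neg => //; have := cond_pos e; lra.
  have Hin : a <= phi z - e <= b by have := cond_pos e; lra.
  have := Hz z (phi z - e) Dz Hin (fun v => v < 0) (open_lt 0 _ Hn).
  rewrite /filtermap /within; apply: filter_imp => z' H Dz'.
  case: (Rlt_dec (phi z - e) (phi z')) => // Hle.
  have [p1 p2] := Hphi z' Dz'; have := H Dz'.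
  case: (Req_dec (phi z - e) (phi z')) => [E|NE]; first by rewrite E; lra.
  have := pos z' (phi z - e) Dz'; lra.
have upE : within D (locally z) (fun z' => phi z' < phi z + e).
  case: (Rlt_dec b (phi z + e)) => Ha.
    by exists e => z' _ Dz'; have := Hphi z' Dz'; lra.
  have Hn : F z (phi z + e) > 0 by apply: pos => //; have := cond_pos e; lra.
  have Hin : a <= phi z + e <= b by have := cond_pos e; lra.
  have := Hz z (phi z + e) Dz Hin (fun v => v > 0) (open_gt 0 _ Hn).
  rewrite /filtermap /within; apply: filter_imp => z' H Dz'.
  case: (Rlt_dec (phi z') (phi z + e)) => // Hle.
  have [p1 p2] := Hphi z' Dz'; have := H Dz'.
  case: (Req_dec (phi z + e) (phi z')) => [E|NE]; first by rewrite E; lra.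
  have := neg z' (phi z + e) Dz'; lra.
have W : within D (locally z) (fun z' => phi z - e < phi z' /\ phi z' < phi z + e).
  exact: filter_and.
apply: filter_imp W => z' [H1 H2].
by rewrite /ball /= /AbsRing_ball /abs /minus /plus /opp /=; apply: Rabs_def1; lra.
Qed.

(** * Common tangents *)

Definition derives_on (J : R -> Prop) (f f' : R -> R) :=
  forall x, J x -> is_derive f x (f' x).

Definition connected_set (J : R -> Prop) :=
  forall a b t, J a -> J b -> a <= t <= b -> J t.

Lemma MVT_on (J : R -> Prop) (f f' : R -> R) (a b : R) :
  connected_set J -> derives_on J f f' -> J a -> J b -> a < b ->
  exists t, a < t < b /\ J t /\ f b - f a = f' t * (b - a).
Proof.
move=> cJ Hf Ja Jb ab.
have [|t [Ht1 Ht2]] := MVT_cor2 f f' a b ab.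
  by move=> t Ht; apply/is_derive_Reals; apply: Hf; apply: (cJ a b).
exists t; split => //; split => //; apply: (cJ a b) => //; lra.
Qed.

Lemma Rolle_on (J : R -> Prop) (f f' : R -> R) (a b : R) :
  connected_set J -> derives_on J f f' -> J a -> J b -> a < b ->
  f a = 0 -> f b = 0 -> exists t, a < t < b /\ J t /\ f' t = 0.
Proof.
move=> cJ Hf Ja Jb ab fa fb; have [t [H1 [H2 H3]]] := MVT_on J f f' a b cJ Hf Ja Jb ab.
exists t; split => //; split => //; rewrite fa fb in H3; nra.
Qed.

Lemma Rolle2_on (J : R -> Prop) (f f' f'' : R -> R) (a b c : R) :
  connected_set J -> derives_on J f f' -> derives_on J f' f'' ->
  J a -> J b -> J c -> a < b -> b < c ->
  f a = 0 -> f b = 0 -> f c = 0 -> exists t, a < t < c /\ J t /\ f'' t = 0.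
Proof.
move=> cJ Hf Hf' Ja Jb Jc ab bc fa fb fc.
have [t [H1 [H2 H3]]] := Rolle_on J f f' a b cJ Hf Ja Jb ab fa fb.
have [u [K1 [K2 K3]]] := Rolle_on J f f' b c cJ Hf Jb Jc bc fb fc.
have tu : t < u by lra.
have [v [L1 [L2 L3]]] := Rolle_on J f' f'' t u cJ Hf' H2 K2 tu H3 K3.
exists v; split => //; lra.
Qed.

Lemma Rolle3_on (J : R -> Prop) (f f' f'' f3 : R -> R) (a b c d : R) :
  connected_set J -> derives_on J f f' -> derives_on J f' f'' -> derives_on J f'' f3 ->
  J a -> J b -> J c -> J d -> a < b -> b < c -> c < d ->
  f a = 0 -> f b = 0 -> f c = 0 -> f d = 0 -> exists t, a < t < d /\ J t /\ f3 t = 0.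
Proof.
move=> cJ Hf Hf' Hf'' Ja Jb Jc Jd ab bc cd fa fb fc fd.
have [t [H1 [H2 H3]]] := Rolle_on J f f' a b cJ Hf Ja Jb ab fa fb.
have [u [K1 [K2 K3]]] := Rolle_on J f f' b c cJ Hf Jb Jc bc fb fc.
have [v [L1 [L2 L3]]] := Rolle_on J f f' c d cJ Hf Jc Jd cd fc fd.
have [s [M1 [M2 M3]]] : exists s, t < s < v /\ J s /\ f3 s = 0.
  by apply: (Rolle2_on J f' f'' f3 t u v) => //; lra.
exists s; split => //; lra.
Qed.

(* Hermite interpolation: the remainder of a function with double zeros at [x]
   and [y] is [f4 xi / 24 * (z - x)^2 * (z - y)^2]. *)
Lemma hermite_pos (J : R -> Prop) (f f1 f2 f3 f4 : R -> R) (x y z : R) :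
  connected_set J -> derives_on J f f1 -> derives_on J f1 f2 ->
  derives_on J f2 f3 -> derives_on J f3 f4 -> (forall t, J t -> 0 < f4 t) ->
  J x -> J y -> J z -> x < y -> f x = 0 -> f1 x = 0 -> f y = 0 -> f1 y = 0 ->
  z <> x -> z <> y -> 0 < f z.
Proof.
move=> cJ H0 H1 H2 H3 Hpos Jx Jy Jz xy fx f1x fy f1y zx zy.
have Kp : 0 < (z - x) ^ 2 * (z - y) ^ 2.
  by apply: Rmult_lt_0_compat; apply: pow2_gt_0; lra.
(* [K] makes [h0] vanish at [z] in addition to its double zeros at [x] and [y]; a zero of [h4],
   which is [f4 - 24 K], then gives [K > 0]. *)
pose K := f z / ((z - x) ^ 2 * (z - y) ^ 2).
have KE : f z = K * ((z - x) ^ 2 * (z - y) ^ 2) by rewrite /K; field; lra.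
pose h0 t := f t - K * ((t - x) ^ 2 * (t - y) ^ 2).
pose h1 t := f1 t - K * (2 * (t - x) * (t - y) ^ 2 + 2 * (t - x) ^ 2 * (t - y)).
pose h2 t := f2 t - K * (2 * (t - y) ^ 2 + 8 * (t - x) * (t - y) + 2 * (t - x) ^ 2).
pose h3 t := f3 t - K * (12 * (t - y) + 12 * (t - x)).
pose h4 t := f4 t - K * 24.
have D0 : derives_on J h0 h1.
  move=> t Jt; rewrite /h0 /h1; apply: is_derive_minus; first exact: H0.
  by auto_derive => //; ring.
have D1 : derives_on J h1 h2.
  move=> t Jt; rewrite /h1 /h2; apply: is_derive_minus; first exact: H1.
  by auto_derive => //; ring.
have D2 : derives_on J h2 h3.
  move=> t Jt; rewrite /h2 /h3; apply: is_derive_minus; first exact: H2.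
  by auto_derive => //; ring.
have D3 : derives_on J h3 h4.
  move=> t Jt; rewrite /h3 /h4; apply: is_derive_minus; first exact: H3.
  by auto_derive => //; ring.
have hx : h0 x = 0 by rewrite /h0 fx; ring.
have hy : h0 y = 0 by rewrite /h0 fy; ring.
have hz : h0 z = 0 by rewrite /h0 KE; ring.
have h1x : h1 x = 0 by rewrite /h1 f1x; ring.
have h1y : h1 y = 0 by rewrite /h1 f1y; ring.
suff [t [Jt Ht]] : exists t, J t /\ h4 t = 0.
  have := Hpos t Jt; move: Ht; rewrite /h4 => Ht Hp.
  rewrite KE; apply: Rmult_lt_0_compat => //; lra.
(* In every position of [z], [h1] vanishes at [x], at [y] and inside each of the two gaps between
   the zeros of [h0]: four zeros, hence a zero of [h4]. *)
case: (Rlt_dec z x) => zx1.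
- have [t [t1 [t2 t3]]] := Rolle_on J h0 h1 z x cJ D0 Jz Jx zx1 hz hx.
  have [u [u1 [u2 u3]]] := Rolle_on J h0 h1 x y cJ D0 Jx Jy xy hx hy.
  by have [v [_ [v2 v3]]] : exists v, t < v < y /\ J v /\ h4 v = 0 by [apply: (Rolle3_on J h1 h2 h3 h4 t x u y) => //; lra]; exists v.
- case: (Rlt_dec z y) => zy1.
  + have xz : x < z by lra.
    have [t [t1 [t2 t3]]] := Rolle_on J h0 h1 x z cJ D0 Jx Jz xz hx hz.
    have [u [u1 [u2 u3]]] := Rolle_on J h0 h1 z y cJ D0 Jz Jy zy1 hz hy.
    by have [v [_ [v2 v3]]] : exists v, x < v < y /\ J v /\ h4 v = 0 by [apply: (Rolle3_on J h1 h2 h3 h4 x t u y) => //; lra]; exists v.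
  + have yz : y < z by lra.
    have [t [t1 [t2 t3]]] := Rolle_on J h0 h1 x y cJ D0 Jx Jy xy hx hy.
    have [u [u1 [u2 u3]]] := Rolle_on J h0 h1 y z cJ D0 Jy Jz yz hy hz.
    by have [v [_ [v2 v3]]] : exists v, x < v < u /\ J v /\ h4 v = 0 by [apply: (Rolle3_on J h1 h2 h3 h4 x t y u) => //; lra]; exists v.
Qed.

Definition bitangent (f f1 : R -> R) (x y : R) :=
  x < y /\ f1 x = f1 y /\ f y - f x = f1 x * (y - x).

Lemma affine_remainder_derives (J : R -> Prop) (f f1 : R -> R) (x s : R) :
  derives_on J f f1 ->
  derives_on J (fun t => f t - f x - s * (t - x)) (fun t => f1 t - s).
Proof.
move=> Hf t Jt; apply: is_derive_minus; last by auto_derive => //; ring.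
rewrite -[f1 t](Rminus_0_r); apply: is_derive_minus; [exact: Hf|exact: is_derive_const].
Qed.

Lemma derives_minus_const (J : R -> Prop) (f f1 : R -> R) (s : R) :
  derives_on J f f1 -> derives_on J (fun t => f t - s) f1.
Proof.
move=> Hf t Jt.
rewrite -[f1 t](Rminus_0_r); apply: is_derive_minus; [exact: Hf|exact: is_derive_const].
Qed.

Section Bitangent.

Variables (J : R -> Prop) (f f1 f2 f3 f4 : R -> R).
Hypotheses (cJ : connected_set J) (H0 : derives_on J f f1) (H1 : derives_on J f1 f2)
  (H2 : derives_on J f2 f3) (H3 : derives_on J f3 f4) (Hpos : forall t, J t -> 0 < f4 t).

Lemma bitangent_above (x y z : R) : J x -> J y -> J z -> bitangent f f1 x y ->
  z <> x -> z <> y -> 0 < f z - f x - f1 x * (z - x).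
Proof.
move=> Jx Jy Jz [xy [e1 e2]] zx zy.
apply: (hermite_pos J (fun t => f t - f x - f1 x * (t - x)) (fun t => f1 t - f1 x)
          f2 f3 f4 x y z) => //; try lra.
- exact: affine_remainder_derives.
- exact: derives_minus_const.
Qed.

(** Rolle for the height above the tangent and then for its derivative, which has a third zero
    inside. These inflections will be a common core of any two contact intervals. *)
Lemma bitangent_inflections (x y : R) : J x -> J y -> bitangent f f1 x y ->
  exists a b, x < a /\ a < b /\ b < y /\ J a /\ J b /\ f2 a = 0 /\ f2 b = 0.
Proof.
move=> Jx Jy [xy [e1 e2]].
have D0 := affine_remainder_derives J f f1 x (f1 x) H0.
have D1 := derives_minus_const J f1 f2 (f1 x) H1.
have [||m [m1 [m2 m3]]] := Rolle_on J _ _ x y cJ D0 Jx Jy xy; try lra.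
have [|||a [a1 [a2 a3]]] := Rolle_on J _ _ x m cJ D1 Jx m2; try lra.
have [|||b [b1 [b2 b3]]] := Rolle_on J _ _ m y cJ D1 m2 Jy; try lra.
exists a, b; repeat split => //; lra.
Qed.

(** [f2] is strictly convex because [f4 > 0], so it has at most two zeros. *)
Lemma inflections_unique (a b a' b' : R) : J a -> J b -> J a' -> J b' ->
  a < b -> a' < b' -> f2 a = 0 -> f2 b = 0 -> f2 a' = 0 -> f2 b' = 0 ->
  a = a' /\ b = b'.
Proof.
move=> Ja Jb Ja' Jb' ab ab' fa fb fa' fb'.
have no3 u v w : J u -> J v -> J w -> u < v -> v < w ->
    f2 u = 0 -> f2 v = 0 -> f2 w = 0 -> False.
  move=> Ju Jv Jw uv vw fu fv fw.
  have [t [_ [Jt t0]]] := Rolle2_on J f2 f3 f4 u v w cJ H2 H3 Ju Jv Jw uv vw fu fv fw.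
  have := Hpos t Jt; lra.
case: (Rtotal_order a a') => [l|[e|l]].
- case: (Rtotal_order b b') => [l'|[e'|l']].
  + by exfalso; exact: (no3 a b b').
  + by exfalso; apply: (no3 a a' b') .
  + by exfalso; apply: (no3 a a' b') .
- split => //; case: (Rtotal_order b b') => [l'|[e'|l']] //; exfalso.
  + exact: (no3 a b b').
  + by apply: (no3 a' b' b).
- exfalso; apply: (no3 a' a b) => //.
Qed.

(** The difference [d] of the two tangent lines is nonnegative at [x] and [y], where the first line
    touches the graph, and nonpositive at [x'] and [y']. Both contact intervals contain the same two
    inflections, so the affine function [d] vanishes on a nontrivial interval and hence everywhere.
    A single line has only its two contact points on the graph. *)
Lemma bitangent_unique (x y x' y' : R) : J x -> J y -> J x' -> J y' ->
  bitangent f f1 x y -> bitangent f f1 x' y' -> x = x' /\ y = y'.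
Proof.
move=> Jx Jy Jx' Jy' B B'.
have [a [b [xa [ab [yb [Ja [Jb [fa fb]]]]]]]] := bitangent_inflections x y Jx Jy B.
have [a' [b' [xa' [ab' [yb' [Ja' [Jb' [fa' fb']]]]]]]] := bitangent_inflections x' y' Jx' Jy' B'.
have [ea eb] := inflections_unique a b a' b' Ja Jb Ja' Jb' ab ab' fa fb fa' fb'.
subst a' b'.
have ge z : J z -> f x + f1 x * (z - x) <= f z.
  move=> Jz; case: (Req_dec z x) => [->|zx]; first lra.
  case: (Req_dec z y) => [->|zy]; first by case: B => _ [_]; lra.
  have := bitangent_above x y z Jx Jy Jz B zx zy; lra.
have ge' z : J z -> f x' + f1 x' * (z - x') <= f z.
  move=> Jz; case: (Req_dec z x') => [->|zx]; first lra.
  case: (Req_dec z y') => [->|zy]; first by case: B' => _ [_]; lra.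
  have := bitangent_above x' y' z Jx' Jy' Jz B' zx zy; lra.
pose d z := (f x + f1 x * (z - x)) - (f x' + f1 x' * (z - x')).
have dx : 0 <= d x by rewrite /d; have := ge' x Jx; lra.
have dy : 0 <= d y by rewrite /d; have := ge' y Jy; case: B => _ [_]; lra.
have dx' : d x' <= 0 by rewrite /d; have := ge x' Jx'; lra.
have dy' : d y' <= 0 by rewrite /d; have := ge y' Jy'; case: B' => _ [_]; lra.
have dE z : d z = d 0 + (f1 x - f1 x') * z by rewrite /d; ring.
have [d0 ds] : d 0 = 0 /\ f1 x - f1 x' = 0.
  rewrite (dE x) in dx; rewrite (dE y) in dy; rewrite (dE x') in dx'; rewrite (dE y') in dy'.
  by split; case: (Rtotal_order (f1 x - f1 x') 0) => [l|[e|l]]; nra.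
have dz z : d z = 0 by rewrite dE d0 ds; ring.
have on z : J z -> f z = f x' + f1 x' * (z - x') -> z = x' \/ z = y'.
  move=> Jz e; case: (Req_dec z x') => zx; [by left|].
  case: (Req_dec z y') => zy; [by right|].
  have := bitangent_above x' y' z Jx' Jy' Jz B' zx zy; lra.
have := on x Jx; have := on y Jy; have := dz x; have := dz y; rewrite /d.
case: B => xy [e1 e2]; case: B' => xy' _ => z1 z2 o1 o2.
case: o1 => [|e|e]; first lra; (case: o2 => [|e'|e']; first lra); split => //; lra.
Qed.

End Bitangent.

(** In the derivative of [phi] the [f1] terms cancel and leave [t * (f2 (m + t) - f2 (m - t))].
    Subtracting [K * t ^ 3] creates a zero at [r]; Rolle and one mean value of [f2] then identify
    [K] as [2 / 3 * f3 xi]. *)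
Lemma trapezoid (J : R -> Prop) (f f1 f2 f3 : R -> R) (m r : R) :
  connected_set J -> derives_on J f f1 -> derives_on J f1 f2 -> derives_on J f2 f3 ->
  J (m - r) -> J (m + r) -> 0 < r ->
  exists xi, m - r < xi < m + r /\ J xi /\
    r * (f1 (m + r) + f1 (m - r)) - (f (m + r) - f (m - r)) = 2 / 3 * r ^ 3 * f3 xi.
Proof.
move=> cJ H0 H1 H2 Jl Jr r0.
pose phi t := t * (f1 (m + t) + f1 (m - t)) - (f (m + t) - f (m - t)).
pose K := phi r / r ^ 3.
have r3 : 0 < r ^ 3 by apply: pow_lt.
have KE : phi r = K * r ^ 3 by rewrite /K; field; lra.
have Jt t : 0 <= t <= r -> J (m + t) /\ J (m - t).
  by move=> Ht; split; apply: (cJ (m - r) (m + r)) => //; lra.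
have Hd : derives_on (fun t => 0 <= t <= r) (fun t => phi t - K * t ^ 3)
   (fun t => t * (f2 (m + t) - f2 (m - t)) - 3 * K * t ^ 2).
  move=> t Ht; have [Jp Jm] := Jt t Ht.
  have comp (g g' : R -> R) (D : derives_on J g g') :
     is_derive (fun s => g (m + s)) t (g' (m + t)) /\ is_derive (fun s => g (m - s)) t (- g' (m - t)).
    split.
      rewrite -[g' (m + t)]Rmult_1_l; apply: (is_derive_comp g); first exact: D.
      by auto_derive => //; ring.
    replace (- g' (m - t)) with (-1 * g' (m - t)) by ring.
    apply: (is_derive_comp g); first exact: D.
    by auto_derive => //; ring.
  have [A1 A2] := comp _ _ H0; have [B1 B2] := comp _ _ H1.
  have E : is_derive phi t (1 * (f1 (m + t) + f1 (m - t)) + t * (f2 (m + t) + - f2 (m - t))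
                            - (f1 (m + t) - - f1 (m - t))).
    apply: is_derive_minus; last exact: is_derive_minus.
    apply: is_derive_mult; [exact: is_derive_id|exact: is_derive_plus|exact: Rmult_comm].
  have E' : is_derive (fun t => K * t ^ 3) t (3 * K * t ^ 2) by auto_derive => //; ring.
  have := is_derive_minus _ _ _ _ _ E E'; congr is_derive.
  by rewrite /minus /plus /opp /=; ring.
have [t [t1 [_ t3]]] : exists t, 0 < t < r /\ 0 <= t <= r /\
    t * (f2 (m + t) - f2 (m - t)) - 3 * K * t ^ 2 = 0.
  apply: (Rolle_on _ _ _ 0 r _ Hd) => //; try lra.
  - by move=> a b s /=; lra.
  - by rewrite /phi Rplus_0_r Rminus_0_r; ring.
have [Jp Jm] : J (m + t) /\ J (m - t) by apply: Jt; lra.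
have mt : m - t < m + t by lra.
have [xi [x1 [x2 x3]]] := MVT_on J f2 f3 (m - t) (m + t) cJ H2 Jm Jp mt.
exists xi; split; [lra|split => //]; rewrite -/(phi r) KE.
rewrite x3 in t3; have : t ^ 2 * (2 * f3 xi - 3 * K) = 0 by nra.
by move=> /Rmult_integral [|] => ?; nra.
Qed.

(** * Limits along a filter *)

Section Limits.

Context {T : Type} (F : (T -> Prop) -> Prop) {FF : Filter F}.

Lemma filter_imp2 (P Q R : T -> Prop) :
  F P -> F Q -> (forall z, P z -> Q z -> R z) -> F R.
Proof.
move=> HP HQ H.
have HPQ : F (fun z => P z /\ Q z) by exact: filter_and.
by apply: filter_imp HPQ => z [H1 H2]; exact: H.
Qed.

Lemma flim_const (a : R) : filterlim (fun _ => a) F (locally a).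
Proof. exact: filterlim_const. Qed.

Lemma flim_plus (f g : T -> R) (a b : R) :
  filterlim f F (locally a) -> filterlim g F (locally b) ->
  filterlim (fun z => f z + g z) F (locally (a + b)).
Proof. move=> Hf Hg; exact: filterlim_comp_2 Hf Hg (filterlim_plus a b). Qed.

Lemma flim_opp (f : T -> R) (a : R) :
  filterlim f F (locally a) -> filterlim (fun z => - f z) F (locally (- a)).
Proof. move=> Hf; exact: filterlim_comp Hf (filterlim_opp a). Qed.

Lemma flim_minus (f g : T -> R) (a b : R) :
  filterlim f F (locally a) -> filterlim g F (locally b) ->
  filterlim (fun z => f z - g z) F (locally (a - b)).
Proof. by move=> Hf Hg; apply: flim_plus => //; exact: flim_opp. Qed.

Lemma flim_mult (f g : T -> R) (a b : R) :
  filterlim f F (locally a) -> filterlim g F (locally b) ->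
  filterlim (fun z => f z * g z) F (locally (a * b)).
Proof. move=> Hf Hg; exact: filterlim_comp_2 Hf Hg (filterlim_mult a b). Qed.

Lemma flim_comp (h : R -> R) (f : T -> R) (a : R) :
  filterlim f F (locally a) -> continuous h a ->
  filterlim (fun z => h (f z)) F (locally (h a)).
Proof. move=> Hf Hh; exact: filterlim_comp Hf Hh. Qed.

Lemma flim_inv (f : T -> R) (a : R) : a <> 0 ->
  filterlim f F (locally a) -> filterlim (fun z => / f z) F (locally (/ a)).
Proof.
move=> a0 Hf; apply: flim_comp => //.
by apply: ex_derive_continuous; auto_derive.
Qed.

Lemma flim_comp2 (g : R -> R -> R) (u v : T -> R) (a b : R) :
  continuity_2d_pt g a b ->
  filterlim u F (locally a) -> filterlim v F (locally b) ->
  filterlim (fun z => g (u z) (v z)) F (locally (g a b)).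
Proof.
move=> Hg Hu Hv; apply/filterlim_locally => e.
have [d Hd] := Hg e.
pose proof (proj1 (filterlim_locally u a) Hu d) as Hu'.
pose proof (proj1 (filterlim_locally v b) Hv d) as Hv'.
by apply: (filter_imp2 _ _ _ Hu' Hv') => z H1 H2; exact: Hd.
Qed.

(** For quotients at a point where their formula degenerates: nearby they are known only as values
    [g xi], with no control on the choice of [xi] except that it is squeezed towards [m0]. *)
Lemma flim_mean_value (g : R -> R -> R) (Q mm rr tt : T -> R) (m0 t0 : R) :
  continuity_2d_pt g m0 t0 ->
  filterlim mm F (locally m0) -> filterlim rr F (locally 0) ->
  filterlim tt F (locally t0) ->
  F (fun z => exists xi, Rabs (xi - mm z) <= rr z /\ Q z = g xi (tt z)) ->
  filterlim Q F (locally (g m0 t0)).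
Proof.
move=> Hg Hm Hr Ht HQ; apply/filterlim_locally => e.
have [d Hd] := Hg e.
have d2 : 0 < d / 2 by have := cond_pos d; lra.
pose proof (proj1 (filterlim_locally mm m0) Hm (mkposreal _ d2)) as Hm'.
pose proof (proj1 (filterlim_locally rr 0) Hr (mkposreal _ d2)) as Hr'.
pose proof (proj1 (filterlim_locally tt t0) Ht d) as Ht'.
apply: (filter_imp2 _ _ _ (filter_and _ _ HQ (filter_and _ _ Hm' Hr')) Ht').
move=> z [[xi [Hxi ->]] [H1 H2]] H3; apply: Hd; last exact: H3.
move: H1 H2; rewrite /ball /= /AbsRing_ball /abs /minus /plus /opp /= => H1 H2.
replace (xi - m0) with ((xi - mm z) + (mm z + - m0)) by ring.
apply: Rle_lt_trans (Rabs_triang _ _) _.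
have := Rle_abs (rr z + - 0); lra.
Qed.

End Limits.

Lemma within_pair {T : Type} (G : (T -> Prop) -> Prop) {FG : Filter G}
  (D : R * R -> Prop) (u v : T -> R) (a b : R) :
  filterlim u G (locally a) -> filterlim v G (locally b) ->
  G (fun t => D (u t, v t)) ->
  filterlim (fun t => (u t, v t)) G (within D (locally (a, b))).
Proof.
move=> Hu Hv HD P [e He].
pose proof (proj1 (filterlim_locally u a) Hu e) as Hu'.
pose proof (proj1 (filterlim_locally v b) Hv e) as Hv'.
apply: (@filter_imp2 T G FG _ _ _ HD (filter_and _ _ Hu' Hv')) => t H0 [H1 H2]; exact: He.
Qed.

Lemma flim_within {T U : UniformSpace} (D : T -> Prop) (f : T -> U) (x : T) (l : U) :
  filterlim f (locally x) (locally l) -> filterlim f (within D (locally x)) (locally l).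
Proof. apply: filterlim_filter_le_1; exact: filter_le_within. Qed.

Lemma derive_flim (J : R -> Prop) (f : R -> R) (x l : R) :
  is_derive f x l -> filterlim f (within J (locally x)) (locally (f x)).
Proof.
by move=> H; apply: flim_within; apply: (ex_derive_continuous f); exists l.
Qed.

(** * The branch of common tangents *)

Section Branch.

Variables (f : nat -> R -> R -> R) (cs ths h e : R).
(** The widths are nested: [f 3] has definite signs at distance [h] from [cs], midpoints are sought
    within [2 h], and with [r <= h] contact points lie within [3 h]. The identities below allow
    midpoints up to [3 h], whose nodes still lie in [J]. *)
Let J c := cs - 4 * h <= c <= cs + 4 * h.
Let D e theta := ths - e < theta <= ths.
Hypotheses (h0 : 0 < h) (e0 : 0 < e)
  (Hd : forall k theta, derives_on J (fun c => f k c theta) (fun c => f (S k) c theta))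
  (Hc : forall k c theta, J c -> continuity_2d_pt (f k) c theta)
  (H4 : forall c theta, J c -> D e theta -> 0 < f 4 c theta)
  (H3m : forall theta, D e theta -> f 3 (cs - h) theta < 0)
  (H3p : forall theta, D e theta -> 0 < f 3 (cs + h) theta)
  (H2n : forall theta, D e theta -> theta < ths -> f 2 cs theta < 0)
  (H2s : f 2 cs ths = 0) (H3s : f 3 cs ths = 0).

Lemma box_connected : connected_set J.
Proof. by move=> a b t; rewrite /J; lra. Qed.

Let Dp (z : R * R) := 0 <= z.1 <= h /\ D e z.2.

(* For [r > 0] the graph of [f 0] has a common tangent at [m - r] and [m + r]
   iff [mean m (r, theta) = 0] and [skew 0 m (r, theta) = 0]. Unlike the
   tangency equations themselves, these two stay nondegenerate at [r = 0], where
   the values are the limits [f 2 m] and [f 3 m]; [skew] is the normalized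
   error of the trapezoidal rule, and its derivative in [m] is [skew 1]. *)
Definition skew (k : nat) (m : R) (z : R * R) : R :=
  if Req_EM_T z.1 0 then f (3 + k) m z.2
  else 3 / 2 * (z.1 * (f (1 + k) (m + z.1) z.2 + f (1 + k) (m - z.1) z.2)
                - (f k (m + z.1) z.2 - f k (m - z.1) z.2)) * / (z.1 * z.1 * z.1).

Definition mean (m : R) (z : R * R) : R :=
  if Req_EM_T z.1 0 then f 2 m z.2
  else (f 1 (m + z.1) z.2 - f 1 (m - z.1) z.2) * / (2 * z.1).

Lemma skew_mean_value (k : nat) (m : R) (z : R * R) :
  cs - 3 * h <= m <= cs + 3 * h -> 0 <= z.1 <= h ->
  exists xi, Rabs (xi - m) <= z.1 /\ J xi /\ skew k m z = f (3 + k) xi z.2.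
Proof.
move=> Hm Hz; rewrite /skew; case: Req_EM_T => [z0|nz] /=.
  by exists m; rewrite z0 Rminus_eq_0 Rabs_R0 /J; repeat split; lra.
have [||| xi [x1 [x2 x3]]] := trapezoid J _ _ _ _ m z.1 box_connected
   (Hd k z.2) (Hd (1 + k) z.2) (Hd (2 + k) z.2); rewrite /J; try lra.
exists xi; split; last split => //.
  by apply: Rabs_le; lra.
by rewrite x3 -[(2 + k).+1]/(3 + k)%nat; field.
Qed.

Lemma mean_mean_value (m : R) (z : R * R) :
  cs - 3 * h <= m <= cs + 3 * h -> 0 <= z.1 <= h ->
  exists xi, Rabs (xi - m) <= z.1 /\ J xi /\ mean m z = f 2 xi z.2.
Proof.
move=> Hm Hz; rewrite /mean; case: Req_EM_T => [z0|nz] /=.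
  by exists m; rewrite z0 Rminus_eq_0 Rabs_R0 /J; repeat split; lra.
have [||| xi [x1 [x2 x3]]] := MVT_on J _ _ (m - z.1) (m + z.1) box_connected (Hd 1 z.2);
  rewrite /J; try lra.
exists xi; split; last split => //.
  by apply: Rabs_le; lra.
by rewrite x3; field.
Qed.

Lemma flim_fst_within (z : R * R) :
  filterlim (fun z' : R * R => z'.1) (within Dp (locally z)) (locally z.1).
Proof. by apply: flim_within; exact: continuous_fst. Qed.

Lemma flim_snd_within (z : R * R) :
  filterlim (fun z' : R * R => z'.2) (within Dp (locally z)) (locally z.2).
Proof. by apply: flim_within; exact: continuous_snd. Qed.

Lemma within_self (z : R * R) : within Dp (locally z) Dp.
Proof. by exists (mkposreal 1 Rlt_0_1). Qed.

Lemma fst_nonzero (z : R * R) : z.1 <> 0 -> within Dp (locally z) (fun z' => z'.1 <> 0).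
Proof.
by move=> nz; apply: (flim_fst_within z (fun v => v <> 0)); exact: (open_neq 0).
Qed.

(** At [r = 0] continuity comes from the mean value form [f (3 + k) xi] with [xi] within [r] of [m];
    elsewhere the quotient formula is locally valid. *)
Lemma skew_continuous (k : nat) (m : R) (z : R * R) : Dp z ->
  cs - 3 * h <= m <= cs + 3 * h ->
  filterlim (skew k m) (within Dp (locally z)) (locally (skew k m z)).
Proof.
move=> [Hz1 Hz2] Hm; rewrite {2}/skew; case: Req_EM_T => [z0|nz].
  apply: (flim_mean_value _ _ _ (fun _ => m) (fun z' => z'.1) (fun z' => z'.2)).
  - by apply: Hc; rewrite /J; lra.
  - exact: flim_const.
  - by rewrite -z0; exact: flim_fst_within.
  - exact: flim_snd_within.
  - apply: (filter_imp Dp _ _ (within_self z)) => z' [H1 _].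
    by have [xi [X1 [_ X2]]] := skew_mean_value k m z' Hm H1; exists xi.
apply: (filterlim_ext_loc (fun z' : R * R =>
   3 / 2 * (z'.1 * (f (1 + k) (m + z'.1) z'.2 + f (1 + k) (m - z'.1) z'.2)
                - (f k (m + z'.1) z'.2 - f k (m - z'.1) z'.2)) * / (z'.1 * z'.1 * z'.1))).
  by apply: (filter_imp (fun z' => z'.1 <> 0) _ _ (fst_nonzero z nz)) => z' nz'; rewrite /skew; case: Req_EM_T.
have F1 := flim_fst_within z; have F2 := flim_snd_within z.
pose proof (flim_plus _ _ _ _ _ (flim_const _ m) F1) as Fp.
pose proof (flim_minus _ _ _ _ _ (flim_const _ m) F1) as Fm.
have Gp k' : filterlim (fun z' : R * R => f k' (m + z'.1) z'.2) (within Dp (locally z)) (locally (f k' (m + z.1) z.2)).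
  by apply: flim_comp2 => //; apply: Hc; rewrite /J; lra.
have Gm k' : filterlim (fun z' : R * R => f k' (m - z'.1) z'.2) (within Dp (locally z)) (locally (f k' (m - z.1) z.2)).
  by apply: flim_comp2 => //; apply: Hc; rewrite /J; lra.
apply: flim_mult.
- apply: flim_mult; [exact: flim_const|apply: flim_minus].
    by apply: flim_mult => //; exact: flim_plus.
  exact: flim_minus.
- apply: flim_inv; first by repeat apply: Rmult_integral_contrapositive_currified.
  by repeat apply: flim_mult.
Qed.

(** The midpoint is allowed to move with [z] because [mean] is later evaluated along
    [midpoint_branch]. *)
Lemma mean_continuous (mm : R * R -> R) (z : R * R) : Dp z ->
  (forall z, Dp z -> cs - 3 * h <= mm z <= cs + 3 * h) ->
  filterlim mm (within Dp (locally z)) (locally (mm z)) ->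
  filterlim (fun z => mean (mm z) z) (within Dp (locally z)) (locally (mean (mm z) z)).
Proof.
move=> Dz Hm Cm; have [Hz1 Hz2] := Dz; have Hmz := Hm z Dz.
rewrite {2}/mean; case: Req_EM_T => [z0|nz].
  apply: (flim_mean_value _ _ _ mm (fun z' => z'.1) (fun z' => z'.2)) => //.
  - by apply: Hc; rewrite /J; lra.
  - by rewrite -z0; exact: flim_fst_within.
  - exact: flim_snd_within.
  - apply: (filter_imp Dp _ _ (within_self z)) => z' Dz'; have [H1 _] := Dz'.
    by have [xi [X1 [_ X2]]] := mean_mean_value (mm z') z' (Hm z' Dz') H1; exists xi.
apply: (filterlim_ext_loc (fun z' : R * R =>
   (f 1 (mm z' + z'.1) z'.2 - f 1 (mm z' - z'.1) z'.2) * / (2 * z'.1))).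
  by apply: (filter_imp (fun z' => z'.1 <> 0) _ _ (fst_nonzero z nz)) => z' nz'; rewrite /mean; case: Req_EM_T.
have F1 := flim_fst_within z; have F2 := flim_snd_within z.
apply: flim_mult.
- apply: flim_minus; apply: flim_comp2 => //; try (by apply: Hc; rewrite /J; lra).
    exact: flim_plus.
  exact: flim_minus.
- apply: flim_inv; first lra.
  by apply: flim_mult => //; exact: flim_const.
Qed.

Lemma skew_derive (m : R) (z : R * R) : Dp z -> cs - 3 * h <= m <= cs + 3 * h ->
  is_derive (fun m => skew 0 m z) m (skew 1 m z).
Proof.
move=> [Hz1 Hz2] Hm; rewrite /skew; case: Req_EM_T => [z0|nz].
  by apply: Hd; rewrite /J; lra.
have comp k : is_derive (fun s => f k (s + z.1) z.2) m (f (S k) (m + z.1) z.2) /\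
              is_derive (fun s => f k (s - z.1) z.2) m (f (S k) (m - z.1) z.2).
  split.
    rewrite -[f _ _ _]Rmult_1_l; apply: (is_derive_comp (fun c => f k c z.2)).
      by apply: (Hd k z.2); rewrite /J; lra.
    by auto_derive => //; ring.
  rewrite -[f _ _ _]Rmult_1_l; apply: (is_derive_comp (fun c => f k c z.2)).
    by apply: (Hd k z.2); rewrite /J; lra.
  by auto_derive => //; ring.
have [A1 A2] := comp 0%nat; have [B1 B2] := comp 1%nat.
have E : is_derive (fun s => z.1 * (f 1 (s + z.1) z.2 + f 1 (s - z.1) z.2)
            - (f 0 (s + z.1) z.2 - f 0 (s - z.1) z.2)) m
         (z.1 * (f 2 (m + z.1) z.2 + f 2 (m - z.1) z.2)
            - (f 1 (m + z.1) z.2 - f 1 (m - z.1) z.2)).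
  apply: is_derive_minus; last exact: is_derive_minus.
  by apply: is_derive_scal; exact: is_derive_plus.
pose proof (is_derive_scal _ _ (3 / 2 * / (z.1 * z.1 * z.1)) _ E) as E'.
replace (3 / 2 * _ * _) with (3 / 2 * / (z.1 * z.1 * z.1) *
    (z.1 * (f 2 (m + z.1) z.2 + f 2 (m - z.1) z.2) - (f 1 (m + z.1) z.2 - f 1 (m - z.1) z.2))).
  by apply: is_derive_ext E' => t; rewrite ?(addn0, add1n) /=; ring.
by rewrite ?(addn0, add1n) /=; ring.
Qed.

(** At [m = cs - 2 h] and [m = cs + 2 h] the point [xi] of the mean value form is at distance at
    least [h] from [cs], on the same side, and [f 3] is increasing, so the signs at [cs - h] and
    [cs + h] decide. Two roots in [m] would by Rolle give a zero of [skew 1], which is a value of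
    [f 4]. *)
Lemma midpoint_branch : exists mm : R * R -> R, forall z, Dp z ->
  cs - 2 * h <= mm z <= cs + 2 * h /\ skew 0 (mm z) z = 0 /\
  filterlim mm (within Dp (locally z)) (locally (mm z)).
Proof.
apply: (implicit_root _ Dp (fun z m => skew 0 m z)); first lra.
- move=> z m Dz Hm; apply: derive_flim; apply: skew_derive => //; lra.
- move=> z m Dz Hm; apply: skew_continuous => //; lra.
- move=> [r th] Dz; have [/= Hz1 Hz2] := Dz.
  have mono a b : J a -> J b -> a < b -> f 3 a th < f 3 b th.
    move=> Ja Jb ab; have [t [_ [Jt Ht]]] := MVT_on J _ _ a b box_connected (Hd 3 th) Ja Jb ab.
    have := H4 t th Jt Hz2; simpl in Ht; nra.
  split.
    have [||xi [X1 [X2 ->]]] := skew_mean_value 0 (cs - 2 * h) (r, th) => /=; try lra.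
    simpl in X1; move/Rabs_le_between: X1 => X1; have := H3m th Hz2.
    case: (Req_dec xi (cs - h)) => [->|ne]; first by rewrite addn0; lra.
    have := mono xi (cs - h) X2; rewrite addn0 => M M0; apply: Rle_trans (Rlt_le _ _ M0).
    by apply: Rlt_le; apply: M; rewrite /J; lra.
  have [||xi [X1 [X2 ->]]] := skew_mean_value 0 (cs + 2 * h) (r, th) => /=; try lra.
  simpl in X1; move/Rabs_le_between: X1 => X1; have := H3p th Hz2.
  case: (Req_dec xi (cs + h)) => [->|ne]; first by rewrite addn0; lra.
  have := mono (cs + h) xi; rewrite addn0 => M M0; apply: Rle_trans (Rlt_le _ _ M0) _.
  by apply: Rlt_le; apply: M => //; rewrite /J; lra.
- move=> [r th] m1 m2 Dz a1 m12 b2 E1 E2; have [/= Hz1 Hz2] := Dz.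
  have [m [M1 [M2 M3]]] : exists m, m1 < m < m2 /\ cs - 3 * h <= m <= cs + 3 * h /\
      skew 1 m (r, th) = 0.
    have cI : connected_set (fun m => cs - 3 * h <= m <= cs + 3 * h) by move=> a b t; lra.
    apply: (Rolle_on _ (fun m => skew 0 m (r, th)) _ m1 m2 cI) => //; try lra.
    by move=> m Hm; exact: skew_derive.
  have [xi [_ [X2]]] := skew_mean_value 1 m (r, th) M2 Hz1.
  have := H4 xi th X2 Hz2; rewrite M3 -[(3 + 1)%nat]/4%nat /= => ? ?; lra.
Qed.

(** [f 4 > 0] makes [f 2] strictly convex on [J], so its critical point [m] is its strict
    minimizer. *)
Lemma second_derivative_min (m c th : R) : J m -> J c -> D e th -> f 3 m th = 0 ->
  m <> c -> f 2 m th < f 2 c th.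
Proof.
move=> Jm Jc Dth f3m mc.
have gt0 t : J t -> m < t -> 0 < f 3 t th.
  move=> Jt mt; have [s [_ [Js Hs]]] := MVT_on J _ _ m t box_connected (Hd 3 th) Jm Jt mt.
  have := H4 s th Js Dth; simpl in Hs; nra.
have lt0 t : J t -> t < m -> f 3 t th < 0.
  move=> Jt mt; have [s [_ [Js Hs]]] := MVT_on J _ _ t m box_connected (Hd 3 th) Jt Jm mt.
  have := H4 s th Js Dth; simpl in Hs; nra.
case: (Rlt_dec m c) => mc'.
  have [s [s1 [Js Hs]]] := MVT_on J _ _ m c box_connected (Hd 2 th) Jm Jc mc'.
  have := gt0 s Js; simpl in Hs; nra.
have cm : c < m by lra.
have [s [s1 [Js Hs]]] := MVT_on J _ _ c m box_connected (Hd 2 th) Jc Jm cm.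
have := lt0 s Js; simpl in Hs; nra.
Qed.

Lemma bitangent_of_roots (m r th : R) : 0 < r -> skew 0 m (r, th) = 0 ->
  mean m (r, th) = 0 -> bitangent (fun c => f 0 c th) (fun c => f 1 c th) (m - r) (m + r).
Proof.
move=> r0; rewrite /skew /mean; case: Req_EM_T => /= [|_]; first lra.
rewrite ?(addn0, add1n) => S M.
have E1 : f 1 (m + r) th - f 1 (m - r) th = 0.
  have I : 0 < / (2 * r) by apply: Rinv_0_lt_compat; lra.
  by case/Rmult_integral: M => //; lra.
case/Rmult_integral: S => [S|S]; last first.
  have : 0 < / (r * r * r) by apply: Rinv_0_lt_compat; repeat apply: Rmult_lt_0_compat.
  by lra.
split; [lra|split; [lra|]]; nra.
Qed.

(** A common tangent needs two zeros of [f 2], and at least one of them is not the minimizer [m],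
    where [f 2] is already nonnegative. *)
Lemma no_bitangent_double (x y m th : R) : D e th -> J x -> J y -> J m ->
  f 3 m th = 0 -> 0 <= f 2 m th ->
  ~ bitangent (fun c => f 0 c th) (fun c => f 1 c th) x y.
Proof.
move=> Dth Jx Jy Jm f3m f2m B.
have [a [b [_ [ab [_ [Ja [Jb [fa fb]]]]]]]] := bitangent_inflections J _ _ _ box_connected
   (Hd 0 th) (Hd 1 th) x y Jx Jy B.
case: (Req_dec m a) => [ma|ma].
  by have := second_derivative_min m b th Jm Jb Dth f3m; lra.
by have := second_derivative_min m a th Jm Ja Dth f3m ma; lra.
Qed.

(** [G th r] is the average of [f 2] over the interval of half-width [r] about the midpoint. At
    [r = 0] it is the minimum of [f 2], which is at most [f 2 cs th <= 0]; at [r = h] it is positive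
    for [th] near [ths], and this is what determines [e']. *)
Lemma bitangent_branch : exists e', 0 < e' <= e /\ exists x y : R -> R, forall th, D e' th ->
  cs - 3 * h <= x th <= cs + 3 * h /\ cs - 3 * h <= y th <= cs + 3 * h /\
  (th < ths -> bitangent (fun c => f 0 c th) (fun c => f 1 c th) (x th) (y th)) /\
  (th = ths -> x th = cs /\ y th = cs) /\
  filterlim x (within (D e') (locally th)) (locally (x th)) /\
  filterlim y (within (D e') (locally th)) (locally (y th)).
Proof.
have [mm Hmm] := midpoint_branch.
pose G th r := mean (mm (r, th)) (r, th).
have mb z : Dp z -> cs - 3 * h <= mm z <= cs + 3 * h.
  by move=> /Hmm [? _]; lra.
have Gc z : Dp z -> filterlim (fun z => mean (mm z) z) (within Dp (locally z)) (locally (G z.2 z.1)).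
  move=> Dz; have [_ [_ Cm]] := Hmm z Dz.
  rewrite /G -surjective_pairing; exact: mean_continuous.
have bit r th : 0 < r <= h -> D e th -> G th r = 0 ->
    bitangent (fun c => f 0 c th) (fun c => f 1 c th) (mm (r, th) - r) (mm (r, th) + r).
  move=> Hr Dth G0; have Dz : Dp (r, th) by split => //=; lra.
  by apply: bitangent_of_roots; [lra|apply (Hmm _ Dz)|].
have zero th : D e th -> f 3 (mm (0, th)) th = 0 /\ G th 0 = f 2 (mm (0, th)) th.
  move=> Dth; have Dz : Dp (0, th) by split => //=; lra.
  have [_ [+ _]] := Hmm _ Dz; rewrite /G /skew /mean.
  by case: Req_EM_T => //= _; rewrite addn0.
have Jm r th : 0 <= r <= h -> D e th -> J (mm (r, th)) /\ J (mm (r, th) - r) /\ J (mm (r, th) + r).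
  move=> Hr Dth; have Dz : Dp (r, th) by split => //=; lra.
  by have := mb _ Dz; rewrite /J; lra.
have Jcs : J cs by rewrite /J; lra.
have Ds : D e ths by rewrite /D; lra.
(* At [ths] the minimum of [f 2] is [0], attained at [cs], so the average is nonnegative; the value
   [0] would give a common tangent, which [no_bitangent_double] excludes. *)
have Gs : 0 < G ths h.
  have Dz : Dp (h, ths) by split => //=; lra.
  have [|xi [_ [Jxi Hxi]]] := mean_mean_value (mm (h, ths)) (h, ths) (mb _ Dz); first by simpl; lra.
  have G0 : 0 <= G ths h.
    rewrite /G Hxi /=; case: (Req_dec cs xi) => [<-|ne]; first lra.
    by have := second_derivative_min cs xi ths Jcs Jxi Ds H3s ne; lra.
  case: (Req_dec (G ths h) 0) => [E|]; last lra.
  have [|_ [Jl Jr]] := Jm h ths _ Ds; first lra.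
  have B := bit h ths (conj h0 (Rle_refl h)) Ds E.
  by exfalso; apply: (no_bitangent_double _ _ cs ths Ds Jl Jr Jcs H3s) B; lra.
have [e' [He' Gp]] : exists e', 0 < e' <= e /\ forall th, D e' th -> 0 < G th h.
  have Dz : Dp (h, ths) by split => //=; lra.
  have [d Hd'] := Gc _ Dz (fun v => 0 < v) (open_gt 0 _ Gs).
  exists (Rmin d e); split; first by split; [apply: Rmin_pos => //; exact: cond_pos|exact: Rmin_r].
  move=> th [T1 T2]; have := Rmin_l d e; have := Rmin_r d e => M1 M2.
  apply: (Hd' (h, th)); last by split => /=; [lra|split; lra].
  split; first exact: ball_center.
  by rewrite /ball /= /AbsRing_ball /abs /minus /plus /opp /=; apply: Rabs_def1; lra.
have De th : D e' th -> D e th by rewrite /D; lra.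
have [rr Hrr] : exists phi : R -> R, forall th, D e' th ->
    0 <= phi th <= h /\ G th (phi th) = 0 /\
    filterlim phi (within (D e') (locally th)) (locally (phi th)).
  apply: (implicit_root _ (D e') G); first lra.
  - move=> th r Dth Hr; have Dz : Dp (r, th) by split => //=; exact: De.
    apply: (filterlim_comp _ _ _ (fun r => (r, th)) (fun z => mean (mm z) z)) (Gc _ Dz).
    apply: within_pair; [by apply: flim_within; exact: filterlim_id|exact: filterlim_const|].
    by exists (mkposreal 1 Rlt_0_1) => r' _ Hr'; split => //=; exact: De.
  - move=> th r Dth Hr; have Dz : Dp (r, th) by split => //=; exact: De.
    apply: (filterlim_comp _ _ _ (fun th => (r, th)) (fun z => mean (mm z) z)) (Gc _ Dz).
    apply: within_pair; [exact: filterlim_const|by apply: flim_within; exact: filterlim_id|].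
    by exists (mkposreal 1 Rlt_0_1) => th' _ Dth'; split => //=; exact: De.
  - move=> th Dth; split; last by apply: Rlt_le; exact: Gp.
    have [f3m ->] := zero th (De _ Dth).
    have [|J0 _] := Jm 0 th _ (De _ Dth); first lra.
    have f2c : f 2 cs th <= 0.
      case: (Rlt_dec th ths) => tt; first by apply: Rlt_le; apply: H2n => //; exact: De.
      have tE : th = ths by move: Dth; rewrite /D; lra.
      by rewrite tE; lra.
    case: (Req_dec (mm (0, th)) cs) => [->//|ne].
    by have := second_derivative_min _ cs th J0 Jcs (De _ Dth) f3m ne; lra.
  (* Two positive roots give two common tangents with different half-widths. A root at [0] means
     that [f 2] has minimum [0], which excludes any common tangent. *)
  - move=> th r1 r2 Dth0 r10 r12 r2h E1 E2; have Dth := De _ Dth0.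
    have [|_ [Jl Jr]] := Jm r2 th _ Dth; first lra.
    have B2 : bitangent (fun c => f 0 c th) (fun c => f 1 c th) (mm (r2, th) - r2) (mm (r2, th) + r2).
      by apply: bit => //; lra.
    case: (Req_dec r1 0) => [r1e|r1n].
      subst r1; have [f3m Gz] := zero th Dth; have [|J0 _] := Jm 0 th _ Dth; first lra.
      by apply: (no_bitangent_double _ _ _ th Dth Jl Jr J0 f3m) B2; lra.
    have [|_ [Jl' Jr']] := Jm r1 th _ Dth; first lra.
    have B1 : bitangent (fun c => f 0 c th) (fun c => f 1 c th) (mm (r1, th) - r1) (mm (r1, th) + r1).
      by apply: bit => //; lra.
    have [] := bitangent_unique J _ _ _ _ _ box_connected (Hd 0 th) (Hd 1 th) (Hd 2 th) (Hd 3 th)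
       (fun t Jt => H4 t th Jt Dth) _ _ _ _ Jl Jr Jl' Jr' B2 B1.
    lra.
have mc th : D e' th ->
    filterlim (fun th => mm (rr th, th)) (within (D e') (locally th)) (locally (mm (rr th, th))).
  move=> Dth; have [r1 [_ rc]] := Hrr th Dth.
  have Dz : Dp (rr th, th) by split => //=; exact: De.
  apply: (filterlim_comp _ _ _ (fun th => (rr th, th)) mm); last by apply (Hmm _ Dz).
  apply: within_pair => //; first by apply: flim_within; exact: filterlim_id.
  exists (mkposreal 1 Rlt_0_1) => th' _ Dth'; split => //=; last exact: De.
  by have [] := Hrr th' Dth'.
exists e'; split => //.
exists (fun th => mm (rr th, th) - rr th), (fun th => mm (rr th, th) + rr th) => th Dth.
have [r1 [Gr rc]] := Hrr th Dth.
have Dz : Dp (rr th, th) by split => //=; exact: De.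
have [m1 _] := Hmm _ Dz.
split; first lra.
split; first lra.
split.
  move=> tt; suff rn : rr th <> 0 by apply: bit => //; [lra|exact: De].
  move=> r0; rewrite r0 in Gr; have [f3m Gz] := zero th (De _ Dth).
  have [|J0 _] := Jm 0 th _ (De _ Dth); first lra.
  have := H2n th (De _ Dth) tt.
  case: (Req_dec (mm (0, th)) cs) => [e1|ne]; first by rewrite -e1; lra.
  by have := second_derivative_min _ cs th J0 Jcs (De _ Dth) f3m ne; lra.
split.
  (* At [ths] a positive half-width is impossible, and the midpoint left at [r = 0] is the unique
     minimizer of [f 2], namely [cs]. *)
  move=> tt; rewrite {}tt in Dth r1 Gr rc Dz m1 *.
  have r0 : rr ths = 0.
    case: (Req_dec (rr ths) 0) => // rn; exfalso.
    have rp : 0 < rr ths <= h by lra.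
    have [|_ [Jl Jr]] := Jm (rr ths) ths _ Ds; first lra.
    by apply: (no_bitangent_double _ _ cs ths Ds Jl Jr Jcs H3s) (bit _ _ rp Ds Gr); lra.
  rewrite r0; suff mE : mm (0, ths) = cs by rewrite mE; lra.
  have [f3m _] := zero ths Ds; have [|J0 _] := Jm 0 ths _ Ds; first lra.
  case: (Req_dec (mm (0, ths)) cs) => // ne.
  have := second_derivative_min _ cs ths J0 Jcs Ds f3m ne.
  by have := second_derivative_min cs _ ths Jcs J0 Ds H3s (not_eq_sym ne); lra.
by split; [apply: flim_minus|apply: flim_plus] => //; exact: mc.
Qed.

End Branch.

(** * Smoothness and orbits of scalar equations *)

(** Level [0] asks for nothing and each level asks for one more derivative on [D]. This suits
    bootstrapping: if derivatives are expressed by the functions themselves, each level follows from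
    the previous one with no base case to prove. *)
Fixpoint Ck (D : R -> Prop) (n : nat) (f : R -> R) : Prop :=
  match n with
  | 0%nat => True
  | S n => exists f', derives_on D f f' /\ Ck D n f'
  end.

Lemma Ck_pred D n f : Ck D (S n) f -> Ck D n f.
Proof.
by elim: n f => [|n IH] f // [f' [Hd Hf']]; exists f'; split => //; exact: IH.
Qed.

Lemma Ck_const D n (a : R) : Ck D n (fun _ => a).
Proof.
elim: n a => [|n IH] a //=; exists (fun _ => 0); split => // x _.
exact: is_derive_const.
Qed.

Lemma Ck_id D n : Ck D n (fun x => x).
Proof.
case: n => [|n] //=; exists (fun _ => 1); split; last exact: Ck_const.
move=> x _; exact: is_derive_id.
Qed.

Lemma Ck_plus D n f g : Ck D n f -> Ck D n g -> Ck D n (fun x => f x + g x).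
Proof.
elim: n f g => [|n IH] f g //= [f' [Hf Hf']] [g' [Hg Hg']].
exists (fun x => f' x + g' x); split; last exact: IH.
by move=> x Dx; apply: is_derive_plus; [exact: Hf|exact: Hg].
Qed.

Lemma Ck_opp D n f : Ck D n f -> Ck D n (fun x => - f x).
Proof.
elim: n f => [|n IH] f //= [f' [Hf Hf']].
exists (fun x => - f' x); split; last exact: IH.
by move=> x Dx; apply: is_derive_opp; exact: Hf.
Qed.

Lemma Ck_mult D n f g : Ck D n f -> Ck D n g -> Ck D n (fun x => f x * g x).
Proof.
elim: n f g => [|n IH] f g // Hf0 Hg0.
have Hf1 := Ck_pred _ _ _ Hf0; have Hg1 := Ck_pred _ _ _ Hg0.
case: Hf0 => [f' [Hf Hf']]; case: Hg0 => [g' [Hg Hg']].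
exists (fun x => f' x * g x + f x * g' x); split; last by apply: Ck_plus; exact: IH.
by move=> x Dx; apply: is_derive_mult; [exact: Hf|exact: Hg|exact: Rmult_comm].
Qed.

Lemma Ck_comp D E n h f : Ck E n h -> Ck D n f -> (forall x, D x -> E (f x)) ->
  Ck D n (fun x => h (f x)).
Proof.
move=> + + HE; elim: n h f HE => [|n IH] h f HE // [h' [Hh Hh']] Hf0.
have Hf1 := Ck_pred _ _ _ Hf0; case: Hf0 => [f' [Hf Hf']].
exists (fun x => f' x * h' (f x)); split; last by apply: Ck_mult => //; exact: IH.
move=> x Dx; apply: (is_derive_comp h); last exact: Hf.
by apply: Hh; exact: HE.
Qed.

Lemma Ck_inv n : Ck (fun x => x <> 0) n Rinv.
Proof.
elim: n => [|n IH] //=; exists (fun x => - (/ x * / x)); split.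
  by move=> x Dx; auto_derive => //; field.
by apply: Ck_opp; exact: Ck_mult.
Qed.

Lemma Ck_ln n : Ck (fun x => 0 < x) n ln.
Proof.
case: n => [|n] //=; exists Rinv; split.
  by move=> x Dx; auto_derive => //; field; lra.
apply: (Ck_comp _ (fun x => x <> 0) _ Rinv (fun x => x)); [exact: Ck_inv|exact: Ck_id|move=> x; lra].
Qed.

Lemma Ck_sqrt n : Ck (fun x => 0 < x) n sqrt.
Proof.
elim: n => [|n IH] //=; exists (fun x => / 2 * / sqrt x); split.
  move=> x Dx; have sx := sqrt_lt_R0 x Dx; auto_derive => //; field; lra.
apply: Ck_mult; first exact: Ck_const.
apply: (Ck_comp _ (fun x => x <> 0)) => //; first exact: Ck_inv.
move=> x Dx; have := sqrt_lt_R0 x Dx; lra.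
Qed.

Lemma Ck_Derive_n D f : (forall k x, D x -> ex_derive_n f k x) ->
  forall n k, Ck D n (Derive_n f k).
Proof.
move=> Hf; elim => [|n IH] k //=; exists (Derive_n f (S k)); split; last exact: IH.
by move=> x Dx; apply: Derive_correct; apply: (Hf (S k)).
Qed.

Lemma Ck_smooth f : (forall n, Ck (fun _ => True) n f) -> smooth f.
Proof.
move=> Hf [|k] x //.
suff H : forall k g, Ck (fun _ => True) (S k) g -> forall x, ex_derive (Derive_n g k) x.
  exact: H.
move=> {k x}; elim => [|k IH] g.
  by move=> [g' [Hg _]] x; exists (g' x); exact: Hg.
move=> [g' [Hg Hg']] x.
apply: (ex_derive_ext (Derive_n g' k)); last exact: IH.
move=> t; rewrite -[(S k)]addn1 -Derive_n_comp; apply: Derive_n_ext => s /=.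
by apply: esym; apply: is_derive_unique; exact: Hg.
Qed.

(** * Derivatives of implicitly defined functions *)

(** Carathéodory's form of the derivative: a slope function defined also at [y = x], so that
    increments which may vanish are never divided by. *)
Lemma derive_slope (f : R -> R) (x l : R) :
  is_derive f x l <->
  exists k : R -> R, (forall y, f y - f x = k y * (y - x)) /\
    filterlim k (locally x) (locally l).
Proof.
split.
- move=> /is_derive_Reals H.
  exists (fun y => if Req_EM_T y x then l else (f y - f x) / (y - x)); split.
    by move=> y; case: Req_EM_T => [E|ne] /=; [rewrite E; ring|field; lra].
  apply/filterlim_locally => e.
  have [d Hd] := H e (cond_pos e); exists d => y Hy.
  case: Req_EM_T => [_|ne] /=; first exact: ball_center.
  have := Hd (y - x) (Rminus_eq_contra _ _ ne) Hy.
  by rewrite Rplus_minus.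
- move=> [k [Hk Hl]]; apply/is_derive_Reals => e e0.
  have [d Hd] := proj1 (filterlim_locally k l) Hl (mkposreal e e0).
  exists d => h h0 Hh; rewrite Hk.
  replace (k (x + h) * (x + h - x) / h) with (k (x + h)) by (field; lra).
  apply: (Hd (x + h)); rewrite /ball /= /AbsRing_ball /abs /minus /plus /opp /=.
  by replace (x + h + - x) with h by ring.
Qed.

(** The increment of [F] along the graph is [0] and splits into [q c' * (u c' - u c)], taken at the
    moving [c'], and [k c' * (c' - c)], taken at the fixed value [u c]. Continuity of [u] and the
    mean value form give the limit of [q], hence that of [- k / q]. *)
Lemma implicit_derive (F Fu : R -> R -> R) (u : R -> R) (c Fc : R) :
  locally c (fun c' => F c' (u c') = 0) -> continuous u c ->
  is_derive (fun c' => F c' (u c)) c Fc ->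
  locally c (fun c' => forall v, Rmin (u c) (u c') <= v <= Rmax (u c) (u c') ->
     is_derive (F c') v (Fu c' v)) ->
  continuity_2d_pt Fu c (u c) -> Fu c (u c) <> 0 ->
  is_derive u c (- Fc / Fu c (u c)).
Proof.
move=> F0 uc HFc HFu CFu Fu0.
pose q c' := if Req_EM_T (u c') (u c) then Fu c' (u c)
             else (F c' (u c') - F c' (u c)) / (u c' - u c).
have qE c' : F c' (u c') - F c' (u c) = q c' * (u c' - u c).
  by rewrite /q; case: Req_EM_T => [E|ne] /=; [rewrite E; ring|field; lra].
have ql : filterlim q (locally c) (locally (Fu c (u c))).
  apply: (flim_mean_value _ (fun v c' => Fu c' v) _ (fun _ => u c)
            (fun c' => Rabs (u c' - u c)) (fun c' => c')).
  - move=> e; have [d Hd] := CFu e; exists d => v c' H1 H2; exact: Hd.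
  - exact: filterlim_const.
  - have -> : 0 = Rabs (u c - u c) by rewrite Rminus_eq_0 Rabs_R0.
    apply: flim_comp; last by apply: continuous_Rabs.
    by apply: flim_minus; [exact: uc|exact: filterlim_const].
  - exact: filterlim_id.
  - apply: filter_imp HFu => c' H; rewrite /q; case: Req_EM_T => [E|ne] /=.
      by exists (u c); rewrite Rminus_eq_0 Rabs_R0; split => //; exact: Rabs_pos.
    have [xi [x1 x2]] : exists xi, Rmin (u c) (u c') <= xi <= Rmax (u c) (u c') /\
        F c' (u c') - F c' (u c) = Fu c' xi * (u c' - u c).
      apply: MVT_gen => v Hv; first by apply: H; lra.
      apply/continuity_pt_filterlim; apply: (ex_derive_continuous (F c')).
      by exists (Fu c' v); exact: H.
    exists xi; split; last by rewrite x2; field; lra.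
    move: x1; rewrite /Rmin /Rmax; case: Rle_dec => ? ?; rewrite /Rabs;
      repeat case: Rcase_abs => ?; lra.
have [k [kE kl]] := proj1 (derive_slope _ _ _) HFc.
apply/derive_slope.
exists (fun c' => if Req_EM_T c' c then - Fc / Fu c (u c) else (u c' - u c) / (c' - c)); split.
  by move=> c'; case: Req_EM_T => [E|ne] /=; [rewrite E; ring|field; lra].
have L : filterlim (fun c' => - k c' * / q c') (locally c) (locally (- Fc / Fu c (u c))).
  by apply: flim_mult; [exact: flim_opp|exact: flim_inv].
have F0c := locally_singleton _ _ F0.
have q0 : locally c (fun c' => q c' <> 0) by apply: (ql (fun v => v <> 0)); exact: (open_neq 0).
have E : locally c (fun c' => c' <> c -> - k c' * / q c' = (u c' - u c) / (c' - c)).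
  apply: (filter_imp2 _ _ _ _ F0 q0) => c' F0' q0' ne.
  have := qE c'; have := kE c'; rewrite F0' F0c => k1 q1.
  have : k c' * (c' - c) = - (q c' * (u c' - u c)) by lra.
  by move=> kq; apply: (Rmult_eq_reg_r (q c' * (c' - c))); [field_simplify; lra|nra].
apply/filterlim_locally => e.
pose proof (proj1 (filterlim_locally _ _) L e) as L'.
apply: (filter_imp2 _ _ _ _ E L') => c' E' L0.
case: Req_EM_T => [_|ne] /=; first exact: ball_center.
by rewrite -E'.
Qed.

(** * Connecting orbits of a scalar equation *)

Lemma open_interval_connected (x y : R) : connected_set (fun z => x < z < y).
Proof. by move=> a b t; lra. Qed.

(* The time of flight [T c], the integral of [1 / Phi] from a midpoint [c0] to
   [c], diverges logarithmically at both ends; the orbit is its inverse. *)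
Lemma heteroclinic_orbit (Phi : R -> R) (x y C : R) : x < y -> 0 < C ->
  (forall z, x < z < y -> continuous Phi z) ->
  (forall z, x < z < y -> 0 < Phi z <= C * (z - x)) ->
  (forall z, x < z < y -> Phi z <= C * (y - z)) ->
  exists g : R -> R, (forall t, x < g t < y) /\
    (forall t, is_derive g t (Phi (g t))) /\
    is_lim g m_infty x /\ is_lim g p_infty y.
Proof.
move=> xy C0 cPhi Pl Pr.
have cJ := open_interval_connected x y.
pose c0 := (x + y) / 2; have c0xy : x < c0 < y by rewrite /c0; lra.
pose T c := RInt (fun z => / Phi z) c0 c.
have dT : derives_on (fun z => x < z < y) T (fun z => / Phi z).
  have cont z : x < z < y -> continuous (fun z => / Phi z) z.
    move=> Hz; apply: flim_inv; last exact: cPhi.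
    by have := Pl z Hz; lra.
  move=> c Hc; apply: is_derive_RInt (cont c Hc).
  have cd : 0 < Rmin (c - x) (y - c) by apply: Rmin_pos; lra.
  exists (mkposreal _ cd) => b.
  rewrite /ball /= /AbsRing_ball /abs /minus /plus /opp /= => /Rabs_def2 Hb.
  have := Rmin_l (c - x) (y - c); have := Rmin_r (c - x) (y - c) => M1 M2.
  apply: RInt_correct; apply: ex_RInt_continuous => z Hz; apply: cont.
  by move: Hz; rewrite /Rmin /Rmax; case: Rle_dec => ? ?; lra.
have Tmono a b : x < a -> a < b -> b < y -> T a < T b.
  move=> xa ab b_y; have [||t [_ [t1 t2]]] := MVT_on _ _ _ a b cJ dT _ _ ab; try lra.
  have := Rinv_0_lt_compat _ (proj1 (Pl t t1)); nra.
have Tinj a b : x < a < y -> x < b < y -> T a < T b -> a < b.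
  move=> Ha Hb Tab; case: (Rlt_dec a b) => // nab.
  case: (Req_dec a b) => [E|ne]; first by rewrite E in Tab; lra.
  by have := Tmono b a; lra.
have Tup c : c0 < c < y -> T c0 + / C * (ln (y - c0) - ln (y - c)) <= T c.
  move=> Hc.
  have D : derives_on (fun z => x < z < y) (fun z => T z + / C * ln (y - z))
             (fun z => / Phi z + / C * (- / (y - z))).
    move=> z Hz; apply: is_derive_plus; first exact: dT.
    by auto_derive; [lra|field; lra].
  have [|||t [_ [t1 t2]]] := MVT_on _ _ _ c0 c cJ D; try lra.
  have Pt := Pl t t1; have Pt' := Pr t t1.
  have I : / (C * (y - t)) <= / Phi t by apply: Rinv_le_contravar; lra.
  rewrite Rinv_mult in I; simpl in t2; nra.
have Tlo c : x < c < c0 -> T c <= T c0 - / C * (ln (c0 - x) - ln (c - x)).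
  move=> Hc.
  have D : derives_on (fun z => x < z < y) (fun z => T z - / C * ln (z - x))
             (fun z => / Phi z - / C * (/ (z - x))).
    move=> z Hz; apply: is_derive_minus; first exact: dT.
    by auto_derive; [lra|field; lra].
  have [|||t [_ [t1 t2]]] := MVT_on _ _ _ c c0 cJ D; try lra.
  have Pt := Pl t t1.
  have I : / (C * (t - x)) <= / Phi t by apply: Rinv_le_contravar; lra.
  rewrite Rinv_mult in I; simpl in t2; nra.
have T0 : T c0 = 0 by rewrite /T RInt_point.
have Tsurj t : exists c, x < c < y /\ T c = t.
  (* The factor by which the distance to an endpoint is shrunk so that the logarithmic bound on [T]
     there exceeds [Rabs t], by exactly [1]. *)
  pose E := exp (- (C * (Rabs t + 1))).
  have t0 := Rabs_pos t.
  have E0 : 0 < E by exact: exp_pos.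
  have E1 : E < 1 by rewrite -exp_0; apply: exp_increasing; nra.
  have lnE d : 0 < d -> / C * (ln d - ln (d * E)) = Rabs t + 1.
    by move=> d0; rewrite ln_mult // ln_exp; field; lra.
  pose b := y - (y - c0) * E; pose a := x + (c0 - x) * E.
  have Hb : c0 < b < y by rewrite /b; nra.
  have Ha : x < a < c0 by rewrite /a; nra.
  have Tb := Tup b Hb; have Ta := Tlo a Ha.
  replace (y - b) with ((y - c0) * E) in Tb by (rewrite /b; ring).
  replace (a - x) with ((c0 - x) * E) in Ta by (rewrite /a; ring).
  rewrite lnE in Tb; last lra; rewrite lnE in Ta; last lra.
  have t1 := Rle_abs t; have t2 := Rle_abs (- t); rewrite Rabs_Ropp in t2.
  have [|c' Hc'|||c [Hc Tc]] := IVT_within (fun z => T z - t) a b; try lra.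
    apply: derive_flim; apply: is_derive_minus; last exact: is_derive_const.
    by apply: dT; lra.
  by exists c; split; lra.
pose g t := proj1_sig (constructive_indefinite_description _ (Tsurj t)).
have gP t : x < g t < y /\ T (g t) = t.
  exact: proj2_sig (constructive_indefinite_description _ (Tsurj t)).
exists g; split; [by move=> t; apply gP|split; [|split]].
- move=> t; apply/is_derive_Reals => e e0.
  have [gt Tt] := gP t.
  have [d Hd] := proj1 (filterlim_locally _ _) (cPhi _ gt) (mkposreal e e0).
  (* The mean value theorem for [T] gives [g (t + h) - g t = Phi xi * h]. As [Phi <= C * (y - x)],
     this bound on [h] puts [xi] within [d] of [g t], so continuity and derivative of [g] are
     obtained together. *)
  have d1 : 0 < d / (C * (y - x)).
    by apply: Rdiv_lt_0_compat; [exact: cond_pos|nra].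
  exists (mkposreal _ d1) => h h0 Hh; simpl in Hh.
  have [gh Th] := gP (t + h).
  have [xi [x1 [x2 x3]]] : exists xi, Rabs (xi - g t) <= Rabs (g (t + h) - g t) /\ x < xi < y /\
     g (t + h) - g t = Phi xi * h.
    case: (Rlt_dec 0 h) => hp.
      have gg : g t < g (t + h) by apply: Tinj => //; lra.
      have [xi [x1 [x2 x3]]] := MVT_on _ _ _ _ _ cJ dT gt gh gg.
      have := Pl xi x2; exists xi; split; last split => //.
        by rewrite !Rabs_pos_eq; lra.
      rewrite Th Tt in x3.
      have -> : Phi xi * h = Phi xi * (/ Phi xi * (g (t + h) - g t)) by congr (_ * _); lra.
      by field; lra.
    have gg : g (t + h) < g t by apply: Tinj => //; lra.
    have [xi [x1 [x2 x3]]] := MVT_on _ _ _ _ _ cJ dT gh gt gg.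
    have := Pl xi x2; exists xi; split; last split => //.
      by rewrite !Rabs_left1; lra.
    rewrite Th Tt in x3.
    have -> : Phi xi * h = Phi xi * (/ Phi xi * (g (t + h) - g t)) by congr (_ * _); lra.
    by field; lra.
  rewrite x3; replace (Phi xi * h / h) with (Phi xi) by (field; lra).
  apply: (Hd xi); rewrite /ball /= /AbsRing_ball /abs /minus /plus /opp /=.
  apply: Rle_lt_trans x1 _; rewrite x3 Rabs_mult.
  have := Pl xi x2 => P1; rewrite (Rabs_pos_eq (Phi xi)); last lra.
  have Cxy : 0 < C * (y - x) by nra.
  have : Rabs h * (C * (y - x)) < d.
    replace (pos d) with (d / (C * (y - x)) * (C * (y - x))) by (field; nra).
    exact: Rmult_lt_compat_r.
  have PC : Phi xi <= C * (y - x) by nra.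
  have := Rmult_le_compat_r _ _ _ (Rabs_pos h) PC; lra.
- apply/is_lim_spec => e.
  pose a := Rmin c0 (x + e / 2); have e0 := cond_pos e.
  have Ha : x < a < y /\ a < x + e.
    by rewrite /a /Rmin; case: Rle_dec => ?; lra.
  exists (T a) => t Ht; have [gt Tt] := gP t.
  have : g t < a by apply: Tinj => //; lra.
  by move=> ga; apply: Rabs_def1; lra.
- apply/is_lim_spec => e.
  pose a := Rmax c0 (y - e / 2); have e0 := cond_pos e.
  have Ha : x < a < y /\ y - e < a.
    by rewrite /a /Rmax; case: Rle_dec => ?; lra.
  exists (T a) => t Ht; have [gt Tt] := gP t.
  have : a < g t by apply: Tinj => //; lra.
  by move=> ga; apply: Rabs_def1; lra.
Qed.

Lemma within_open_continuous (D : R -> Prop) (f : R -> R) (x : R) : open D -> D x ->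
  filterlim f (within D (locally x)) (locally (f x)) -> continuous f x.
Proof.
move=> oD Dx H P HP; apply: (filter_imp2 _ _ _ _ (oD x Dx) (H P HP)) => z Dz; exact.
Qed.

(** * Profile of a phase boundary *)

Section Wave.

Variables (tau1 delta P x y s : R) (w : R -> R).
Let w1 := Derive w.
Let G c := w c - w x - s * (c - x).
Hypotheses (Htau1 : 0 < tau1 < 1) (Hdelta : 0 < delta) (HP : 0 < P < 1)
  (x0 : 0 < x) (xy : x < y) (y1 : y < 1)
  (Hw : forall k c, 0 < c < 1 -> ex_derive_n w k c)
  (HG0 : forall c, x < c < y -> 0 < G c)
  (HGx : forall c, x < c < y -> G c <= (c - x) ^ 2)
  (HGy : forall c, x < c < y -> G c <= (y - c) ^ 2)
  (HGs : forall c, x < c < y -> G c < (1 - c) / 12).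

(* With [u = P / p], the drop of [U + (P + p) tau / 2] when the pressure is
   lowered from [P] to [p] at fixed [c]. *)
Definition drop (c u : R) : R :=
  (1 - c) * (ln u + / 2 - u / 2) + P * tau1 / 2 * (c * (1 - / u)).

Definition drop_u (c u : R) : R := (1 - c) * (/ u - / 2) + P * tau1 / 2 * (c * (/ u * / u)).

Definition drop_c (u : R) : R := - (ln u + / 2 - u / 2) + P * tau1 / 2 * (1 - / u).

Lemma drop_derive_u (c u : R) : 0 < u -> is_derive (drop c) u (drop_u c u).
Proof.
by move=> u0; rewrite /drop /drop_u; auto_derive; [repeat split => //; lra|field; lra].
Qed.

(** The range [u <= 3 / 2] keeps [/ u - / 2] at least [2 / 3 - / 2 = / 6]; this term vanishes at
    [u = 2]. *)
Lemma drop_u_lower (c u : R) : 0 < c < 1 -> 1 <= u <= 3 / 2 -> (1 - c) / 6 <= drop_u c u.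
Proof.
move=> Hc Hu; rewrite /drop_u.
have I : / (3 / 2) <= / u by apply: Rinv_le_contravar; lra.
have I2 : / (3 / 2) = 2 / 3 by field.
have : 0 <= P * tau1 / 2 * (c * (/ u * / u)).
  by repeat (apply: Rmult_le_pos); lra.
rewrite I2 in I; nra.
Qed.

(** At [u = 3 / 2] this gives [(1 - c) / 12], the bound imposed on [G] in [HGs]; together with
    [drop c 1 = 0] it brackets the root of [drop c u = G c]. *)
Lemma drop_lower (c u : R) : 0 < c < 1 -> 1 <= u <= 3 / 2 -> (1 - c) / 6 * (u - 1) <= drop c u.
Proof.
move=> Hc Hu; have D1 : drop c 1 = 0 by rewrite /drop ln_1; field.
case: (Req_dec u 1) => [->|ne]; first by rewrite D1; lra.
have cI : connected_set (fun u => 1 <= u <= 3 / 2) by move=> a b t; lra.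
have [|||| t [_ [t1 t2]]] := MVT_on _ (drop c) (drop_u c) 1 u cI; try lra.
  by move=> v Hv; apply: drop_derive_u; lra.
rewrite D1 in t2; have := drop_u_lower c t Hc t1; nra.
Qed.

Lemma G_derive (c : R) : 0 < c < 1 -> is_derive G c (w1 c - s).
Proof.
move=> Hc; apply: is_derive_minus; last by auto_derive => //; ring.
rewrite -[w1 c]Rminus_0_r; apply: is_derive_minus; last exact: is_derive_const.
by apply: Derive_correct; exact: (Hw 1 c Hc).
Qed.

Lemma wave_pressure : exists uu : R -> R, forall c, x < c < y ->
  1 < uu c < 3 / 2 /\ drop c (uu c) = G c /\ continuous uu c /\
  is_derive uu c ((w1 c - s - drop_c (uu c)) / drop_u c (uu c)).
Proof.
have D1 c : drop c 1 = 0 by rewrite /drop ln_1; field.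
have D2 c : x < c < y -> (1 - c) / 12 <= drop c (3 / 2).
  by move=> Hc; have := drop_lower c (3 / 2); lra.
have [uu Huu] : exists uu : R -> R, forall c, x < c < y ->
    1 <= uu c <= 3 / 2 /\ drop c (uu c) - G c = 0 /\
    filterlim uu (within (fun c => x < c < y) (locally c)) (locally (uu c)).
  apply: (implicit_root _ _ (fun c u => drop c u - G c)); first lra.
  - move=> c u Hc Hu; apply: derive_flim; apply: is_derive_minus; last exact: is_derive_const.
    by apply: drop_derive_u; lra.
  - move=> c u Hc Hu; apply: derive_flim; apply: is_derive_minus; last by apply: G_derive; lra.
    by rewrite /drop; auto_derive.
  - by move=> c Hc; rewrite D1; have := D2 c Hc; have := HG0 c Hc; have := HGs c Hc; lra.
  - move=> c u1 u2 Hc a1 u12 b2 e1 e2.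
    have cI : connected_set (fun u => 1 <= u <= 3 / 2) by move=> a b t; lra.
    have [|||| t [_ [t1 t2]]] := MVT_on _ (drop c) (drop_u c) u1 u2 cI; try lra.
      by move=> v Hv; apply: drop_derive_u; lra.
    have := drop_u_lower c t; nra.
exists uu => c Hc; have [u1 [u2 u3]] := Huu c Hc.
have uc : continuous uu c.
  apply: (within_open_continuous (fun c => x < c < y)) => //.
  by apply: open_and; [exact: open_gt|exact: open_lt].
have strict : 1 < uu c < 3 / 2.
  have H0 := HG0 c Hc; have Hs := HGs c Hc; have H2 := D2 c Hc.
  split.
    case: (Req_dec (uu c) 1) => [E|]; last lra.
    by rewrite E D1 in u2; lra.
  case: (Req_dec (uu c) (3 / 2)) => [E|]; last lra.
  by rewrite E in u2; lra.
split => //; split; first lra; split => //.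
have Dn : drop_u c (uu c) <> 0 by have := drop_u_lower c (uu c); lra.
have near : locally c (fun c' => x < c' < y).
  have oI : open (fun c => x < c < y) by apply: open_and; [exact: open_gt|exact: open_lt].
  exact: oI.
replace ((w1 c - s - drop_c (uu c)) / drop_u c (uu c))
  with (- (drop_c (uu c) - (w1 c - s)) / drop_u c (uu c)) by (field; lra).
apply: (implicit_derive (fun c u => drop c u - G c) drop_u) => //.
- by apply: filter_imp near => c' Hc'; have [_ [? _]] := Huu c' Hc'.
- apply: is_derive_minus; last by apply: G_derive; lra.
  by rewrite /drop /drop_c; auto_derive => //; ring.
- apply: filter_imp near => c' Hc' v Hv.
  rewrite -[drop_u c' v]Rminus_0_r; apply: is_derive_minus; last exact: is_derive_const.
  apply: drop_derive_u; have [? _] := Huu c' Hc'.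
  by move: Hv; rewrite /Rmin /Rmax; case: Rle_dec => ?; lra.
- apply/continuity_2d_pt_filterlim; rewrite /drop_u.
  have F1 : filterlim (fun z : R * R => z.1) (locally (c, uu c)) (locally c) by exact: (continuous_fst).
  have F2 : filterlim (fun z : R * R => z.2) (locally (c, uu c)) (locally (uu c)) by exact: (continuous_snd).
  have F3 : filterlim (fun z : R * R => / z.2) (locally (c, uu c)) (locally (/ uu c)).
    by apply: flim_inv => //; lra.
  apply: flim_plus; apply: flim_mult.
  + by apply: flim_minus => //; exact: flim_const.
  + by apply: flim_minus => //; exact: flim_const.
  + exact: flim_const.
  + by apply: flim_mult => //; exact: flim_mult.
Qed.

(** The value of [c'^2] in [delta * rho * c'^2 = P - p] for [p = P / u] and [rho = / spec_vol c u],
    with [P] multiplied into the volume. *)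
Definition speed2 (c u : R) : R := (1 - / u) * (c * tau1 * P + (1 - c) * u) / delta.

(** The pressure law [p = (1 - c) / (tau - c * tau1)] solved for [tau] at [p = P / u]. *)
Definition spec_vol (c u : R) : R := c * tau1 + (1 - c) * (u / P).

Lemma wave_profile : exists c u : R -> R,
  (forall t, x < c t < y) /\ (forall t, 1 < u t < 3 / 2) /\
  (forall n, Ck (fun _ => True) n c) /\ (forall n, Ck (fun _ => True) n u) /\
  (forall t, 0 < Derive c t) /\
  (forall t, Derive c t * Derive c t = speed2 (c t) (u t)) /\
  (forall t, is_derive (fun t => delta * / spec_vol (c t) (u t) * Derive c t) t
     (/ spec_vol (c t) (u t) * (w1 (c t) - s + ln (u t) - tau1 * P * (1 - / u t)))) /\
  is_lim c m_infty x /\ is_lim c p_infty y /\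
  is_lim u m_infty 1 /\ is_lim u p_infty 1.
Proof.
have [uu Huu] := wave_pressure.
pose Phi c := sqrt (speed2 c (uu c)).
have Spos c u : 0 < c < 1 -> 1 < u < 3 / 2 -> 0 < speed2 c u.
  move=> Hc Hu; rewrite /speed2; apply: Rdiv_lt_0_compat => //.
  have I : / u < 1 by rewrite -[1]Rinv_1; apply: Rinv_lt_contravar; lra.
  apply: Rmult_lt_0_compat; first lra.
  by apply: Rplus_lt_0_compat; repeat apply: Rmult_lt_0_compat; lra.
(* [15 = 6 * (5 / 2)]: [drop_lower] gives [u - 1 <= 6 / (1 - y) * G], which also bounds [1 - / u],
   and the remaining factor of [speed2] is at most [1 + 3 / 2]. *)
pose C2 := 15 / ((1 - y) * delta).
have yd : 0 < (1 - y) * delta by apply: Rmult_lt_0_compat; lra.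
have C20 : 0 < C2 by apply: Rdiv_lt_0_compat; lra.
have uub c : x < c < y -> uu c - 1 <= 6 / (1 - y) * G c.
  move=> Hc; have [u1 [u2 _]] := Huu c Hc.
  have := drop_lower c (uu c); rewrite u2 => dl.
  have : (1 - y) / 6 * (uu c - 1) <= G c by nra.
  move=> H; have : 6 / (1 - y) * ((1 - y) / 6 * (uu c - 1)) <= 6 / (1 - y) * G c.
    by apply: Rmult_le_compat_l => //; apply: Rlt_le; apply: Rdiv_lt_0_compat; lra.
  by replace (6 / (1 - y) * ((1 - y) / 6 * (uu c - 1))) with (uu c - 1) by (field; lra).
have Sub c : x < c < y -> speed2 c (uu c) <= C2 * G c.
  move=> Hc; have [u1 _] := Huu c Hc; have ub := uub c Hc.
  have -> : C2 * G c = (6 / (1 - y) * G c) * (5 / 2) / delta by rewrite /C2; field; lra.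
  rewrite /speed2; apply: Rmult_le_compat_r; first by apply: Rlt_le; apply: Rinv_0_lt_compat.
  have I : / uu c < 1 by rewrite -[1]Rinv_1; apply: Rinv_lt_contravar; lra.
  have I2 : 1 - / uu c <= uu c - 1.
    suff : 0 <= (uu c - 1) * (1 - / uu c) by have : uu c * / uu c = 1 by [field; lra]; lra.
    by apply: Rmult_le_pos; lra.
  apply: Rmult_le_compat; try lra.
    by apply: Rplus_le_le_0_compat; repeat apply: Rmult_le_pos; lra.
  have : c * tau1 * P <= 1 by have : c * tau1 <= 1 by [nra]; have : 0 <= c * tau1 by [nra]; nra.
  nra.
have Phib c d : x < c < y -> 0 <= d -> G c <= d ^ 2 -> Phi c <= sqrt C2 * d.
  move=> Hc d0 Gd; rewrite /Phi -{1}(sqrt_pow2 d d0) -sqrt_mult; try nra.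
  apply: sqrt_le_1_alt; apply: Rle_trans (Sub c Hc) _; nra.
have [||||c [cI [cD [cl cr]]]] := heteroclinic_orbit Phi x y (sqrt C2) xy.
- exact: sqrt_lt_R0.
- move=> c Hc; have [u1 [_ [uc _]]] := Huu c Hc.
  apply: flim_comp; last by apply: continuous_sqrt.
  apply: flim_mult; last exact: flim_const.
  have ci : filterlim (fun c : R => c) (locally c) (locally c) by exact: filterlim_id.
  apply: flim_mult.
    by apply: flim_minus; [exact: flim_const|apply: flim_inv => //; lra].
  apply: flim_plus.
    by apply: flim_mult; [apply: flim_mult => //; exact: flim_const|exact: flim_const].
  by apply: flim_mult => //; apply: flim_minus => //; exact: flim_const.
- move=> c Hc; have [u1 _] := Huu c Hc; split.
    by apply: sqrt_lt_R0; apply: Spos => //; lra.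
  by apply: Phib => //; [lra|exact: HGx].
- by move=> c Hc; apply: Phib => //; [lra|exact: HGy].
pose u t := uu (c t).
have uI t : 1 < u t < 3 / 2 by have [? _] := Huu _ (cI t).
pose U1 c u := (w1 c - s - drop_c u) / drop_u c u.
pose z t := Phi (c t).
have zE t : Derive c t = z t by exact: is_derive_unique.
have St t : 0 < speed2 (c t) (u t) by apply: Spos => //; have := cI t; lra.
have zpos t : 0 < z t by apply: sqrt_lt_R0; exact: St.
have zz t : z t * z t = speed2 (c t) (u t).
  by rewrite /z /Phi sqrt_sqrt //; apply: Rlt_le; exact: St.
have uD t : is_derive u t (z t * U1 (c t) (u t)).
  have [_ [_ [_ ud]]] := Huu _ (cI t).
  exact: (is_derive_comp uu c t _ _ ud (cD t)).
have dun t : drop_u (c t) (u t) <> 0.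
  by have := drop_u_lower (c t) (u t); have := cI t; have := uI t; lra.
(* Joint bootstrap: [c' = z] and [u' = z * U1] are smooth expressions in [c] and [u]. Under the
   square root [speed2] is positive, since the orbit never reaches the end points. *)
have Cku n : Ck (fun _ => True) n c /\ Ck (fun _ => True) n u.
  elim: n => [//|n [IHc IHu]].
  have Cinv : Ck (fun _ => True) n (fun t => / u t).
    by apply: (Ck_comp _ _ _ _ _ (Ck_inv n)) => // t _; have := uI t; lra.
  have Cz : Ck (fun _ => True) n z.
    apply: (Ck_comp _ _ _ _ _ (Ck_sqrt n)); last first.
      by move=> t _; exact: St.
    repeat (apply: Ck_mult || apply: Ck_plus || apply: Ck_opp || apply: Ck_const || exact: Cinv || exact: IHc || exact: IHu).
  split; first by exists z; split => // t _; exact: cD.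
  exists (fun t => z t * U1 (c t) (u t)); split; first by move=> t _; exact: uD.
  apply: Ck_mult => //; rewrite /U1 /drop_c.
  have Cw : Ck (fun _ => True) n (fun t => w1 (c t)).
    apply: (Ck_comp _ (fun c => 0 < c < 1) n w1 c) => //.
      by apply: (Ck_Derive_n _ w _ n 1) => k c' Hc'; exact: Hw.
    by move=> t _; have := cI t; lra.
  have Cl : Ck (fun _ => True) n (fun t => ln (u t)).
    by apply: (Ck_comp _ _ _ _ _ (Ck_ln n)) => // t _; have := uI t; lra.
  apply: Ck_mult; last first.
    apply: (Ck_comp _ _ _ _ _ (Ck_inv n)); last by move=> t _; exact: dun.
    repeat (apply: Ck_mult || apply: Ck_plus || apply: Ck_opp || apply: Ck_const || exact: Cinv || exact: IHc || exact: IHu).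
  repeat (apply: Ck_mult || apply: Ck_plus || apply: Ck_opp || apply: Ck_const || exact: Cinv || exact: IHc || exact: IHu || exact: Cw || exact: Cl).
have ulim (F : (R -> Prop) -> Prop) (FF : Filter F) (a : R) : filterlim c F (locally a) ->
    (forall t, G (c t) <= (c t - a) ^ 2) -> filterlim u F (locally 1).
  move=> Fc Ga.
  apply: (filterlim_le_le (fun _ => 1) _ (fun t => 1 + 6 / (1 - y) * ((c t - a) * (c t - a))) 1).
  - apply: filter_forall => t; have := uI t; have := uub _ (cI t); rewrite -/(u t) => ub ul.
    split; first lra.
    have : 6 / (1 - y) * G (c t) <= 6 / (1 - y) * ((c t - a) * (c t - a)).
      apply: Rmult_le_compat_l; first by apply: Rlt_le; apply: Rdiv_lt_0_compat; lra.
      by have := Ga t; lra.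
    by lra.
  - exact: flim_const.
  - have -> : Finite 1 = 1 + 6 / (1 - y) * ((a - a) * (a - a)) by congr Finite; ring.
    apply: flim_plus; first exact: flim_const.
    apply: flim_mult; first exact: flim_const.
    by apply: flim_mult; apply: flim_minus => //; exact: flim_const.
exists c, u; split => //; split => //.
split; first by move=> n; case: (Cku n).
split; first by move=> n; case: (Cku n).
split; first by move=> t; rewrite zE.
split; first by move=> t; rewrite zE.
split; last first.
  split => //; split => //; split.
    by apply: (ulim _ _ x) => // t; exact: HGx.
  apply: (ulim _ _ y) => // t; have := HGy _ (cI t); nra.
move=> t.
have ct := cI t; have ut := uI t.
have tpos : 0 < spec_vol (c t) (u t).
  rewrite /spec_vol; apply: Rplus_lt_0_compat; repeat apply: Rmult_lt_0_compat; try lra.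
  by apply: Rinv_0_lt_compat; lra.
(* The derivative of [speed2 c (uu c)] with respect to [c]. Differentiating [z * z] in time gives
   [2 z z' = z S'], and [z > 0] cancels to [z' = S' / 2]. *)
pose S' := ((/ u t * / u t * (U1 (c t) (u t)) * (c t * tau1 * P + (1 - c t) * u t)
   + (1 - / u t) * (tau1 * P - u t + (1 - c t) * U1 (c t) (u t))) / delta).
have exc : ex_derive c t by exists (z t).
have exu : ex_derive u t by exists (z t * U1 (c t) (u t)).
have zD : is_derive z t (S' / 2).
  have dS : is_derive (fun t => speed2 (c t) (u t)) t (z t * S').
    rewrite /speed2; auto_derive; first by repeat split => //; lra.
    rewrite zE (is_derive_unique _ _ _ (uD t)) /S'; field; lra.
  have := is_derive_comp sqrt (fun t => speed2 (c t) (u t)) t (/ (2 * z t)) _ _ dS.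
  have -> : S' / 2 = scal (z t * S') (/ (2 * z t)).
    by rewrite /scal /= /mult /=; field; have := zpos t; lra.
  apply; have sp := St t.
  change (is_derive sqrt (speed2 (c t) (u t)) (/ (2 * sqrt (speed2 (c t) (u t))))).
  by auto_derive => //; rewrite Rmult_1_l.
apply: (is_derive_ext (fun t => delta * / spec_vol (c t) (u t) * z t)).
  by move=> t'; rewrite zE.
have exz : ex_derive z t by exists (S' / 2).
rewrite /spec_vol; auto_derive; first by rewrite -/(spec_vol (c t) (u t)); repeat split => //; lra.
rewrite zE (is_derive_unique _ _ _ (uD t)) (is_derive_unique _ _ _ zD).
rewrite -/(spec_vol (c t) (u t)).
set A := U1 (c t) (u t); set tau := spec_vol (c t) (u t).
have tau0 : 0 < tau by exact: tpos.
transitivity (/ tau * (- (delta * (z t * z t) / tau) * (tau1 - u t / P + (1 - c t) * A / P)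
                       + delta * S' / 2)).
  by field; repeat split; lra.
have -> : delta * (z t * z t) / tau = (1 - / u t) * P.
  have tauE : c t * tau1 * P + (1 - c t) * u t = tau * P by rewrite /tau /spec_vol; field; lra.
  by rewrite zz /speed2 tauE; field; repeat split; lra.
(* The first integral [drop c (uu c) = G c] differentiated along its graph; it brings the source
   term [w1] into the second-order equation. *)
have W : w1 (c t) - s = A * drop_u (c t) (u t) + drop_c (u t).
  by rewrite /A /U1; field; exact: dun.
rewrite W /S' -/A /drop_u /drop_c; congr (_ * _).
by field; lra.
Qed.

End Wave.

(** * Planar solutions of the system *)

Lemma dx_planar (n : nat) (i : 'I_n.+1) (f : R -> R) (t : R) (X : point n) :
  dx i (planar f) t X = if i == ord0 then Derive f (X ord0) else 0.
Proof.
rewrite /dx /planar; case: (i =P ord0) => [->|/eqP ne].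
  by apply: Derive_ext => z; rewrite eqxx.
rewrite -[RHS](Derive_const (f (X ord0)) (X i)); apply: Derive_ext => z.
by rewrite eq_sym (negbTE ne).
Qed.

Lemma dive_planar (n : nat) (F : 'I_n.+1 -> field n) (h : 'I_n.+1 -> R -> R) (t : R) (X : point n) :
  (forall i s Y, F i s Y = h i (Y ord0)) -> dive F t X = Derive (h ord0) (X ord0).
Proof.
move=> FE; have -> : F = fun i => planar (h i).
  by do 3 (apply: functional_extensionality => ?); exact: FE.
rewrite /dive big_ord_recl dx_planar eqxx; set S := bigop _ _ _.
suff -> : S = 0 by rewrite Rplus_0_r.
rewrite /S; apply: (big_ind (fun r => r = 0)) => //; first by move=> a b -> ->; ring.
by move=> i _; rewrite dx_planar.
Qed.

(** At rest the mass balance and the viscous terms vanish, and the momentum balances transverse to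
    [ord0] are trivial. Both directions serve: one to build a phase boundary, the other to analyse a
    given one. *)
Lemma NSAC_planar (n : nat) (delta mu lambda : R) (p q : R -> R -> R) (rho c : R -> R) :
  0 < delta ->
  NSAC delta mu lambda p q (planar (n := n) rho) (planar_velocity (fun _ => 0)) (planar c) <->
  (forall x, Derive (fun x => p (rho x) (c x)) x
             = Derive (fun x => - (delta * rho x * Derive c x * Derive c x)) x /\
     rho x * q (rho x) (c x) + Derive (fun x => delta * rho x * Derive c x) x = 0).
Proof.
move=> d0.
have vE : planar_velocity (fun _ => 0) = (fun _ _ _ => 0) :> ('I_n.+1 -> field n).
  by do 3 (apply: functional_extensionality => ?); rewrite /planar_velocity; case: ifP.
have dx0 (i : 'I_n.+1) s Y : dx i (fun _ _ => 0 : R) s Y = 0 by rewrite /dx Derive_const.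
rewrite vE /NSAC.
have mass t X : dt (planar (n := n) rho) t X
    + dive (fun i s Y => planar rho s Y * 0) t X = 0.
  rewrite (@dive_planar _ _ (fun _ _ => 0)); last by move=> *; ring.
  by rewrite /dt /planar !Derive_const; ring.
have divv s Y : dive (n := n) (fun _ _ _ => 0) s Y = 0.
  by rewrite (@dive_planar _ _ (fun _ _ => 0)) // Derive_const.
have mom_l (j : 'I_n.+1) t X :
    dt (fun s Y => planar (n := n) rho s Y * 0) t X
    + dive (fun i s Y => planar (n := n) rho s Y * 0 * 0
                         + p (planar rho s Y) (planar c s Y) * kron i j) t X
    = Derive (fun x => p (rho x) (c x) * kron ord0 j) (X ord0).
  rewrite (@dive_planar _ _ (fun i x => p (rho x) (c x) * kron i j)); last by move=> * /=; rewrite /planar; ring.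
  by rewrite /dt /planar Derive_const; ring.
have mom_r (j : 'I_n.+1) t X :
    dive (fun i s Y => mu * (dx i (fun _ _ => 0 : R) s Y + dx j (fun _ _ => 0 : R) s Y)
                           + lambda * dive (fun _ _ _ => 0 : R) s Y * kron i j
                           - delta * planar (n := n) rho s Y * dx i (planar c) s Y * dx j (planar c) s Y) t X
    = Derive (fun x => - (delta * rho x * Derive c x * (if j == ord0 then Derive c x else 0))) (X ord0).
  rewrite (@dive_planar _ _ (fun i x => - (delta * rho x * (if i == ord0 then Derive c x else 0)
                                          * (if j == ord0 then Derive c x else 0)))) //.
  by move=> i s Y; rewrite !dx0 divv !dx_planar /planar; ring.
have frac_l t X : dt (fun s Y => planar (n := n) rho s Y * planar c s Y) t X
    + dive (fun i s Y => planar (n := n) rho s Y * planar c s Y * 0) t X = 0.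
  rewrite (@dive_planar _ _ (fun _ _ => 0)); last by move=> *; ring.
  by rewrite /dt /planar !Derive_const; ring.
have frac_r t X : dive (fun i s Y => delta * planar (n := n) rho s Y * dx i (planar c) s Y) t X
    = Derive (fun x => delta * rho x * Derive c x) (X ord0).
  rewrite (@dive_planar _ _ (fun i x => delta * rho x * (if i == ord0 then Derive c x else 0))) //.
  by move=> i s Y; rewrite dx_planar.
have sd : / sqrt delta <> 0 by apply: Rinv_neq_0_compat; have := sqrt_lt_R0 delta d0; lra.
split.
- move=> H x; have [_ [H1 H2]] := H 0 (fun _ => x); split.
    have := H1 ord0; rewrite mom_l mom_r eqxx => <-.
    by apply: Derive_ext => y; rewrite /kron eqxx Rmult_1_r.
  move: H2; rewrite frac_l frac_r /planar => /esym /Rmult_integral [] //.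
- move=> H t X; have [H1 H2] := H (X ord0); split; first exact: mass.
  split; last by rewrite frac_l frac_r /planar H2 Rmult_0_r.
  move=> j; rewrite mom_l mom_r /kron eq_sym; case: eqP => _.
    by rewrite -H1; apply: Derive_ext => y; rewrite Rmult_1_r.
  by apply: Derive_ext => y; ring.
Qed.

(** * Pressure, reaction rate and states of prescribed pressure *)

Section Thermodynamics.

Variables (tau1 : R) (W : R -> R -> R) (theta : R).
Hypothesis Htau1 : 0 < tau1.
Let U := fluid_energy tau1 W theta.

Definition press (rho c : R) : R := (1 - c) / (/ rho - c * tau1).

Lemma volume_pos (rho c : R) : tau1 < / rho -> 0 < c < 1 -> 0 < / rho - c * tau1.
Proof. by move=> Hr Hc; have : 0 < (1 - c) * tau1 by [apply: Rmult_lt_0_compat; lra]; lra. Qed.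

Lemma press_pos (rho c : R) : tau1 < / rho -> 0 < c < 1 -> 0 < press rho c.
Proof.
by move=> Hr Hc; apply: Rdiv_lt_0_compat; [lra|exact: volume_pos].
Qed.

Lemma pressureE (rho c : R) : tau1 < / rho -> 0 < c < 1 -> pressure U rho c = press rho c.
Proof.
move=> Hr Hc; have Hv := volume_pos rho c Hr Hc; rewrite /pressure /press.
move: Hr Hv; set v := / rho => Hr Hv.
rewrite -[RHS]Ropp_involutive; congr (- _); apply: is_derive_unique.
rewrite /U /fluid_energy; auto_derive.
  by apply: Rdiv_lt_0_compat; lra.
by field; lra.
Qed.

Lemma reactionE (rho c : R) : tau1 < / rho -> 0 < c < 1 -> ex_derive (fun c => W c theta) c ->
  reaction U rho c = ln (press rho c) - tau1 * press rho c + 1 - Derive (fun c => W c theta) c.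
Proof.
move=> Hr Hc HW; have Hv := volume_pos rho c Hr Hc; rewrite /reaction /press.
move: Hr Hv; set v := / rho => Hr Hv.
have -> : ln ((1 - c) / (v - c * tau1)) = - ln ((v - c * tau1) / (1 - c)).
  rewrite -ln_Rinv; last by apply: Rdiv_lt_0_compat; lra.
  by congr ln; field; lra.
rewrite -[RHS]Ropp_involutive; congr (- _); apply: is_derive_unique.
rewrite /U /fluid_energy.
set A := (X in is_derive X); have AE : A = fun c => (- (1 - c) * ln ((v - c * tau1) / (1 - c))) + W c theta by [].
rewrite AE.
replace (- _) with ((ln ((v - c * tau1) / (1 - c)) - 1 + tau1 * ((1 - c) / (v - c * tau1)))
    + Derive (fun c => W c theta) c) by ring.
apply: is_derive_plus; last exact: Derive_correct.
auto_derive; first by repeat split; try lra; apply: Rdiv_lt_0_compat; lra.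
change ((v + - (c * tau1)) * / (1 + - c)) with ((v - c * tau1) / (1 - c)).
by set L := ln _; field; lra.
Qed.

End Thermodynamics.

Lemma Derive_const_plus (a : R) (f : R -> R) (x : R) : Derive (fun t => a + f t) x = Derive f x.
Proof.
rewrite /Derive; congr real; apply: Lim_ext => h; congr (_ / _); ring.
Qed.

Lemma is_derive_reflect (f : R -> R) (x l : R) :
  is_derive f (- x) l -> is_derive (fun t => f (- t)) x (- l).
Proof.
move=> H; replace (- l) with (- 1 * l) by ring.
by apply: (is_derive_comp f) => //; auto_derive => //; ring.
Qed.

Lemma is_lim_reflect_m (f : R -> R) (l : Rbar) : is_lim f p_infty l -> is_lim (fun t => f (- t)) m_infty l.
Proof. move=> H; exact: filterlim_comp (filterlim_Rbar_opp m_infty) H. Qed.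

Lemma is_lim_reflect_p (f : R -> R) (l : Rbar) : is_lim f m_infty l -> is_lim (fun t => f (- t)) p_infty l.
Proof. move=> H; exact: filterlim_comp (filterlim_Rbar_opp p_infty) H. Qed.

(** The pressure law solved for the density at pressure [P]; [critical_state] is the case [P = ps],
    [c = cs]. *)
Definition state_at (tau1 P c : R) : state := (/ (c * tau1 + (1 - c) / P), c).

Lemma volume_above (tau1 v c : R) : 0 < tau1 < 1 -> 0 < c < 1 -> 1 < v ->
  tau1 < c * tau1 + (1 - c) * v.
Proof.
move=> Ht Hc Hv; have : 0 < (1 - c) * (v - tau1) by [apply: Rmult_lt_0_compat; lra]; lra.
Qed.

Lemma inv_gt1 (P : R) : 0 < P < 1 -> 1 < / P.
Proof. by move=> HP; rewrite -Rinv_1; apply: Rinv_lt_contravar; lra. Qed.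

Lemma fluid_state_at (tau1 P c : R) : 0 < tau1 < 1 -> 0 < P < 1 -> 0 < c < 1 ->
  fluid_state tau1 (state_at tau1 P c).
Proof.
move=> Ht HP Hc; have V := volume_above tau1 (/ P) c Ht Hc (inv_gt1 P HP).
have V' : tau1 < c * tau1 + (1 - c) / P by [].
split => /=; first by apply: Rinv_0_lt_compat; lra.
by split => //; rewrite Rinv_inv.
Qed.

Lemma press_state_at (tau1 P c : R) : 0 < P -> 0 < c < 1 ->
  press tau1 (state_at tau1 P c).1 c = P.
Proof.
move=> HP Hc; rewrite /press /= Rinv_inv; field; split; first lra.
by replace (_ - _) with (1 - c) by ring; lra.
Qed.

Lemma state_at_press (tau1 : R) (s : state) : 0 < s.1 -> 0 < s.2 < 1 ->
  0 < press tau1 s.1 s.2 -> s = state_at tau1 (press tau1 s.1 s.2) s.2.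
Proof.
case: s => rho c /= Hr Hc; rewrite /press /state_at => Hp; congr pair.
(* Division by zero returns [0], so a positive [press] excludes a vanishing denominator. *)
have v0 : / rho - c * tau1 <> 0.
  by move=> E; rewrite E /Rdiv Rinv_0 in Hp; lra.
have -> : (1 - c) / ((1 - c) / (/ rho - c * tau1)) = / rho - c * tau1.
  by move: v0; set v := / rho => v0; field; lra.
by replace (_ + _) with (/ rho) by ring; rewrite Rinv_inv.
Qed.

(** * From a common tangent to a phase boundary and its mirror image *)

Section Boundary.

Variables (n : nat) (tau1 delta mu lambda : R) (W : R -> R -> R) (theta : R).
Hypotheses (Htau1 : 0 < tau1 < 1) (Hdelta : 0 < delta).
Let w c := W c theta.
Hypothesis Hw : forall c, 0 < c < 1 -> ex_derive w c.
Let p := pressure (fluid_energy tau1 W theta).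
Let q := reaction (fluid_energy tau1 W theta).

Definition reac (rho c : R) : R :=
  ln (press tau1 rho c) - tau1 * press tau1 rho c + 1 - Derive w c.

Lemma pressure_fluid_state (s : state) : fluid_state tau1 s -> p s.1 s.2 = press tau1 s.1 s.2.
Proof. by move=> [_ [Hr Hc]]; apply: pressureE; lra. Qed.

Lemma reaction_fluid_state (s : state) : fluid_state tau1 s -> q s.1 s.2 = reac s.1 s.2.
Proof. by move=> [_ [Hr Hc]]; apply: reactionE => //; [lra|exact: Hw]. Qed.

Lemma boundary_of_profile (P : R) (rho c : R -> R) (sm sp : state) :
  smooth rho -> smooth c -> (forall x, fluid_state tau1 (rho x, c x)) ->
  (forall x, press tau1 (rho x) (c x) = P - delta * rho x * Derive c x * Derive c x) ->
  (forall x, Derive (fun x => delta * rho x * Derive c x) x = - (rho x * reac (rho x) (c x))) ->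
  (exists x y, c x <> c y) -> fluid_state tau1 sm -> fluid_state tau1 sp ->
  is_lim rho m_infty sm.1 -> is_lim c m_infty sm.2 ->
  is_lim rho p_infty sp.1 -> is_lim c p_infty sp.2 ->
  no_flux_phase_boundary n tau1 delta mu lambda p q rho (fun _ => 0) c sm sp.
Proof.
move=> Sr Sc Hs Hp Hq [x [y xy]] Fm Fp rm cm rp cp; split; last by move=> z; ring.
split => //; split; first by move=> [|k] z //; exact: ex_derive_n_const.
split => //; split => //; split.
  apply/NSAC_planar => // z; split; last first.
    by rewrite Hq (reaction_fluid_state (rho z, c z)) //=; ring.
  rewrite -[RHS](Derive_const_plus P); apply: Derive_ext => t.
  by rewrite (pressure_fluid_state (rho t, c t)) //= Hp; ring.
split; first by exists x, y => E; apply: xy; exact: (congr1 snd E).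
have L0 a : ex_finite_lim (fun _ => 0) a by exists 0; exact: is_lim_const.
by repeat (split => //).
Qed.

Lemma connected_of_bitangent (P x y s : R) : 0 < P < 1 -> 0 < x -> x < y -> y < 1 ->
  (forall k c, 0 < c < 1 -> ex_derive_n w k c) ->
  s = - (tau1 * P - ln P - 1) ->
  (forall c, x < c < y -> 0 < w c - w x - s * (c - x)) ->
  (forall c, x < c < y -> w c - w x - s * (c - x) <= (c - x) ^ 2) ->
  (forall c, x < c < y -> w c - w x - s * (c - x) <= (y - c) ^ 2) ->
  (forall c, x < c < y -> w c - w x - s * (c - x) < (1 - c) / 12) ->
  connected n tau1 delta mu lambda W theta (state_at tau1 P x) (state_at tau1 P y).
Proof.
move=> HP x0 xy y1 Sw sE G0 Gx Gy Gs.
have P1 := inv_gt1 P HP.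
have [c [u [cI [uI [Cc [Cu [cpos [c2 [cD [clm [clp [ulm ulp]]]]]]]]]]]] :=
  wave_profile tau1 delta P x y s w Htau1 Hdelta HP x0 xy y1 Sw G0 Gx Gy Gs.
pose rho t := / spec_vol tau1 P (c t) (u t).
have vol t : tau1 < spec_vol tau1 P (c t) (u t).
  apply: volume_above => //; first by have := cI t; lra.
  have := uI t; rewrite /Rdiv; nra.
have rhoV t : / rho t = spec_vol tau1 P (c t) (u t) by rewrite /rho Rinv_inv.
have Fs t : fluid_state tau1 (rho t, c t).
  split => /=; first by apply: Rinv_0_lt_compat; have := vol t; lra.
  by rewrite rhoV; split => //; have := cI t; lra.
have pr t : press tau1 (rho t) (c t) = P * / u t.
  rewrite /press rhoV /spec_vol; have := cI t; have := uI t => ? ?; field; split; first lra.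
  split; first lra.
  replace (_ - _) with ((1 - c t) * u t) by (field; lra).
  by apply: Rgt_not_eq; apply: Rmult_lt_0_compat; lra.
have Hp t : press tau1 (rho t) (c t) = P - delta * rho t * Derive c t * Derive c t.
  rewrite pr; have -> : delta * rho t * Derive c t * Derive c t = delta * rho t * (Derive c t * Derive c t) by ring.
  rewrite c2 /speed2 /rho; have V := vol t.
  have -> : c t * tau1 * P + (1 - c t) * u t = spec_vol tau1 P (c t) (u t) * P.
    by rewrite /spec_vol; field; lra.
  by have := uI t => ?; field; repeat split; lra.
have Hq t : is_derive (fun t => delta * rho t * Derive c t) t (- (rho t * reac (rho t) (c t))).
  suff -> : - (rho t * reac (rho t) (c t)) =
    rho t * (Derive w (c t) - s + ln (u t) - tau1 * P * (1 - / u t)) by exact: cD.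
  rewrite /reac pr ln_mult; [|lra|by apply: Rinv_0_lt_compat; have := uI t; lra].
  rewrite ln_Rinv; last by have := uI t; lra.
  by rewrite sE /w; ring.
have Crho m : Ck (fun _ => True) m rho.
  apply: (Ck_comp _ _ _ _ _ (Ck_inv m)); last by move=> t _; have := vol t; lra.
  repeat (apply: Ck_mult || apply: Ck_plus || apply: Ck_opp || apply: Ck_const || exact: Cc || exact: Cu).
have rlim (F : (R -> Prop) -> Prop) (FF : Filter F) (a : R) : 0 < a < 1 -> filterlim c F (locally a) ->
    filterlim u F (locally 1) -> filterlim rho F (locally (/ (a * tau1 + (1 - a) / P))).
  move=> Ha Fc Fu; have V := volume_above tau1 (/ P) a Htau1 Ha P1.
  have -> : a * tau1 + (1 - a) / P = a * tau1 + (1 - a) * (1 * / P) by field; lra.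
  apply: flim_inv; first by rewrite Rmult_1_l; lra.
  apply: flim_plus; first by apply: flim_mult => //; exact: flim_const.
  apply: flim_mult; first by apply: flim_minus => //; exact: flim_const.
  by apply: flim_mult => //; exact: flim_const.
have Fx : fluid_state tau1 (state_at tau1 P x) by apply: fluid_state_at => //; lra.
have Fy : fluid_state tau1 (state_at tau1 P y) by apply: fluid_state_at => //; lra.
have rlm : is_lim rho m_infty (state_at tau1 P x).1 by apply: rlim => //; lra.
have rlp : is_lim rho p_infty (state_at tau1 P y).1 by apply: rlim => //; lra.
have cinj a b : a < b -> c a < c b.
  move=> ab; have Dc : derives_on (fun _ => True) c (Derive c).
    by move=> t _; have [c' [c'D _]] := Cc 1%nat; apply: Derive_correct; exists (c' t); exact: c'D.
  have cT : connected_set (fun _ => True) by [].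
  have [t [_ [_ t2]]] := MVT_on _ _ _ a b cT Dc I I ab.
  by have := cpos t; nra.
split; first last; first split.
- exists rho, c; apply: (boundary_of_profile P) => //.
  + exact: Ck_smooth.
  + exact: Ck_smooth.
  + by move=> t; exact: is_derive_unique.
  + by exists 0, 1; have := cinj 0 1 Rlt_0_1; lra.
(* Reflection changes the sign of [c'], but [c'] enters the pressure balance squared and the
   reaction balance under a second derivative. *)
- have neg m f : Ck (fun _ => True) m f -> Ck (fun _ => True) m (fun t => f (- t)).
    by move=> Hf; apply: (Ck_comp _ _ _ _ _ Hf) => //; apply: Ck_opp; exact: Ck_id.
  have cneg t : Derive (fun t => c (- t)) t = - Derive c (- t).
    apply: is_derive_unique; apply: is_derive_reflect; apply: Derive_correct.
    by have [c' [c'D _]] := Cc 1%nat; exists (c' (- t)); exact: c'D.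
  exists (fun t => rho (- t)), (fun t => c (- t)); apply: (boundary_of_profile P) => //.
  + by apply: Ck_smooth => m; exact: neg.
  + by apply: Ck_smooth => m; exact: neg.
  + by move=> t; rewrite Hp cneg; ring.
  + move=> t; rewrite -[RHS]Ropp_involutive; apply: is_derive_unique.
    have E a : - (delta * rho (- a) * Derive c (- a))
               = delta * rho (- a) * Derive (fun t => c (- t)) a by rewrite cneg; ring.
    apply: (is_derive_ext _ _ _ _ E).
    apply: is_derive_opp; exact: (is_derive_reflect (fun t => delta * rho t * Derive c t)).
  + exists 0, 1; have l : - (1) < - 0 by lra.
    by have := cinj _ _ l; lra.
  + exact: is_lim_reflect_m.
  + exact: is_lim_reflect_m.
  + exact: is_lim_reflect_p.
  + exact: is_lim_reflect_p.
(* The volume [c * tau1 + (1 - c) / P] decreases in [c] because [tau1 < 1 < / P]. *)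
- rewrite /=; apply: Rinv_lt_contravar.
    have V := volume_above tau1 (/ P) x Htau1 (conj x0 (Rlt_trans _ _ _ xy y1)) P1.
    have V' := volume_above tau1 (/ P) y Htau1 (conj (Rlt_trans _ _ _ x0 xy) y1) P1.
    by apply: Rmult_lt_0_compat; rewrite /Rdiv; lra.
  by rewrite /Rdiv; nra.
Qed.

End Boundary.

(** * Conservation along a phase boundary *)

(** Since [c] converges, its increments over unit intervals are small, so arbitrarily far out there
    are points with [c'] small. The choice of [e] makes [c'^2] at such a point at most [Rabs L / 4],
    too far from a nonzero [L]. *)
Lemma derivative_limit_zero (c : R -> R) (l L : R) :
  (forall x, ex_derive c x) -> is_lim c p_infty l ->
  is_lim (fun x => Derive c x * Derive c x) p_infty L -> L = 0.
Proof.
move=> Hc /is_lim_spec Hl /is_lim_spec HL.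
case: (Req_dec L 0) => // L0; exfalso.
have aL : 0 < Rabs L / 2 by have := Rabs_pos_lt L L0; lra.
have [M1 H1] := HL (mkposreal _ aL).
pose e := Rmin 1 (Rabs L / 2) / 4.
have e0 : 0 < e by rewrite /e; have := Rmin_pos 1 (Rabs L / 2) Rlt_0_1 aL; lra.
have [M2 H2] := Hl (mkposreal _ e0).
pose x := Rmax M1 M2 + 1.
have x1 : M1 < x by rewrite /x; have := Rmax_l M1 M2; lra.
have x2 : M2 < x by rewrite /x; have := Rmax_r M1 M2; lra.
have Dc : derives_on (fun _ => True) c (Derive c) by move=> t _; exact: Derive_correct.
have cT : connected_set (fun _ => True) by [].
have xx : x < x + 1 by lra.
have [t [t1 [_ t2]]] := MVT_on _ _ _ _ _ cT Dc I I xx.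
have tM : M1 < t by lra.
have := H1 t tM; have := H2 x x2; have y2 : M2 < x + 1 by lra.
have := H2 (x + 1) y2; rewrite /= => /Rabs_def2 A /Rabs_def2 B C.
have d : Rabs (Derive c t) < 2 * e by apply: Rabs_def1; lra.
have e1 : e <= / 4 by rewrite /e; have := Rmin_l 1 (Rabs L / 2); lra.
have e2 : 4 * e <= Rabs L / 2 by rewrite /e; have := Rmin_r 1 (Rabs L / 2); lra.
have dd : Rabs (Derive c t * Derive c t) <= 2 * e.
  by rewrite Rabs_mult; have := Rabs_pos (Derive c t); nra.
have := Rabs_triang (L - Derive c t * Derive c t) (Derive c t * Derive c t).
rewrite Rabs_minus_sym in C.
by replace (L - Derive c t * Derive c t + Derive c t * Derive c t) with L by ring; lra.
Qed.

Lemma constant_of_derive0 (f : R -> R) : (forall x, is_derive f x 0) -> forall x, f x = f 0.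
Proof.
move=> Hf x.
have Df : derives_on (fun _ => True) f (fun _ => 0) by move=> t _; exact: Hf.
have cT : connected_set (fun _ => True) by [].
case: (Rtotal_order x 0) => [l|[->//|l]].
  by have [t [_ [_]]] := MVT_on _ _ _ _ _ cT Df I I l; lra.
by have [t [_ [_]]] := MVT_on _ _ _ _ _ cT Df I I l; lra.
Qed.

Lemma is_lim_constant (f : R -> R) (k : R) (a : Rbar) (l : R) :
  (forall x, f x = k) -> is_lim f a l -> l = k.
Proof.
move=> Hf Hl; have E : Finite l = Finite k.
  rewrite -(is_lim_unique _ _ _ Hl); apply: is_lim_unique.
  by apply: (is_lim_ext (fun _ => k)) => //; exact: is_lim_const.
by case: E.
Qed.

Section WaveEnergy.

Variables (n : nat) (tau1 delta mu lambda : R) (W : R -> R -> R) (theta : R).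
Hypotheses (Htau1 : 0 < tau1 < 1) (Hdelta : 0 < delta).
Let w c := W c theta.
Hypothesis Hw : forall c, 0 < c < 1 -> ex_derive w c.
Let p := pressure (fluid_energy tau1 W theta).
Let q := reaction (fluid_energy tau1 W theta).

Lemma press_flim {T : Type} (F : (T -> Prop) -> Prop) {FF : Filter F} (rho c : T -> R) (s : state) :
  fluid_state tau1 s ->
  filterlim rho F (locally s.1) -> filterlim c F (locally s.2) ->
  filterlim (fun x => press tau1 (rho x) (c x)) F (locally (press tau1 s.1 s.2)).
Proof.
move=> [Hr [Hv Hc]] Fr Fc; have t0 := proj1 Htau1; have V := volume_pos tau1 t0 _ _ Hv Hc.
apply: flim_mult; first by apply: flim_minus => //; exact: flim_const.
apply: flim_inv; first lra.
apply: flim_minus; first by apply: flim_inv => //; lra.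
by apply: flim_mult => //; exact: flim_const.
Qed.

Lemma press_derive (rho c : R -> R) (x r' c' : R) : fluid_state tau1 (rho x, c x) ->
  is_derive rho x r' -> is_derive c x c' ->
  is_derive (fun x => press tau1 (rho x) (c x)) x
   (let v := / rho x - c x * tau1 in
    - c' / v + (1 - c x) * (r' / (rho x * rho x) + c' * tau1) / (v * v)).
Proof.
move=> [/= Hr [Hv Hc]] Dr Dc; have t0 := proj1 Htau1; have V := volume_pos tau1 t0 _ _ Hv Hc.
have er : ex_derive rho x by exists r'.
have ec : ex_derive c x by exists c'.
rewrite /press; auto_derive; first by repeat split => //; lra.
rewrite (is_derive_unique _ _ _ Dr) (is_derive_unique _ _ _ Dc).
have V' : / rho x + - (c x * tau1) <> 0 by lra.
rewrite /Rminus; move: V'; have rr : rho x * / rho x = 1 by field; lra.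
have -> : r' / (rho x * rho x) = r' * (/ rho x * / rho x) by field; lra.
rewrite Rinv_mult; move: (/ rho x) => v V'; field.
by move: V'; rewrite /Rminus.
Qed.

(** Supplies the missing half of the tangency condition: [q = 0] with equal pressures gives equal
    slopes of [w] at the end states, and this balance puts both contact points on one line. *)
Lemma wave_energy (rho c : R -> R) (s1 s2 : state) :
  no_flux_phase_boundary n tau1 delta mu lambda p q rho (fun _ => 0) c s1 s2 ->
  press tau1 s1.1 s1.2 = press tau1 s2.1 s2.2 ->
  let P := press tau1 s1.1 s1.2 in
  s1.2 * (tau1 * P - ln P - 1) + w s1.2 = s2.2 * (tau1 * P - ln P - 1) + w s2.2.
Proof.
move=> [[Sr [_ [Sc [Fs [HN [_ [F1 [F2 [r1 [c1 [_ [r2 [c2 _]]]]]]]]]]]]] _] PE P.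
have t0 := proj1 Htau1.
have ODE := proj1 (NSAC_planar n delta mu lambda p q rho c Hdelta) HN.
have Dr x : is_derive rho x (Derive rho x) by apply: Derive_correct; exact: (Sr 1%nat).
have Dc x : is_derive c x (Derive c x) by apply: Derive_correct; exact: (Sc 1%nat).
have Dcc x : is_derive (Derive c) x (Derive (Derive c) x) by apply: Derive_correct; exact: (Sc 2%nat).
pose pr x := press tau1 (rho x) (c x).
pose z x := Derive c x.
have prE x : p (rho x) (c x) = pr x by exact: (pressure_fluid_state _ _ _ Htau1 (rho x, c x)).
have Dpr x := press_derive rho c x _ _ (Fs x) (Dr x) (Dc x).
have exr x : ex_derive rho x by exists (Derive rho x).
have exc x : ex_derive c x by exists (Derive c x).
have exz x : ex_derive (fun x => Derive c x) x by eexists; exact: Dcc.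
have expr x : ex_derive pr x by eexists; exact: Dpr.
have exk x : ex_derive (fun x => delta * rho x * z x * z x) x by rewrite /z; auto_derive.
have Kc : forall x, pr x + delta * rho x * z x * z x = pr 0 + delta * rho 0 * z 0 * z 0.
  apply: (constant_of_derive0 (fun x => pr x + delta * rho x * z x * z x)) => x.
  have -> : 0 = Derive pr x + Derive (fun x => delta * rho x * z x * z x) x.
    have [+ _] := ODE x; rewrite (Derive_ext _ pr) // Derive_opp => ->.
    by rewrite /z; ring.
  by apply: is_derive_plus; exact: Derive_correct.
move: Kc; set K := _ + _ => Kc.
have rpos s : fluid_state tau1 s -> 0 < s.1 by case.
have zlim (F : (R -> Prop) -> Prop) (FF : Filter F) s : fluid_state tau1 s ->
    press tau1 s.1 s.2 = P ->
    filterlim rho F (locally s.1) -> filterlim c F (locally s.2) ->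
    filterlim (fun x => z x * z x) F (locally ((K - P) * / (delta * s.1))).
  move=> Hs HP Fr Fc.
  have zE x : (K - pr x) * / (delta * rho x) = z x * z x.
    by rewrite -(Kc x); have := rpos _ (Fs x) => /= ?; field; lra.
  apply: (filterlim_ext _ _ zE); apply: flim_mult.
    by apply: flim_minus; [exact: flim_const|rewrite -HP; exact: press_flim].
  apply: flim_inv; first by apply: Rgt_not_eq; apply: Rmult_lt_0_compat => //; exact: rpos.
  by apply: flim_mult => //; exact: flim_const.
(* By [zlim], [z * z] converges because the pressure and [rho] do, and its limit must be [0]. One
   end suffices to identify [K]; [zlim] then gives [0] at the other end too. *)
have KP : K = P.
  pose proof (zlim _ _ s2 F2 (esym PE) r2 c2) as Z.
  have /Rmult_integral [|I0] := derivative_limit_zero c _ _ exc c2 Z; first lra.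
  have d2 : 0 < delta * s2.1 by apply: Rmult_lt_0_compat => //; exact: rpos.
  by have := Rinv_0_lt_compat _ d2; lra.
(* The conserved quantity [U + P tau - delta c'^2 / 2]. *)
pose H x := (1 - c x) * ln (pr x) + w (c x) + P * / rho x - delta / 2 * (z x * z x).
have DH x : is_derive H x 0.
  have [/= Hr [Hv Hc]] := Fs x; have V := volume_pos tau1 t0 _ _ Hv Hc.
  have Pp := press_pos tau1 t0 _ _ Hv Hc.
  have exw : ex_derive (fun x => w (c x)) x by apply: ex_derive_comp => //; exact: Hw.
  have Dw : Derive (fun x => w (c x)) x = Derive c x * Derive w (c x).
    by apply: Derive_comp => //; exact: Hw.
  have [_ Hq] := ODE x.
  have DY : Derive (fun x => delta * rho x * Derive c x) x
     = delta * (Derive rho x * z x + rho x * Derive (Derive c) x).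
    apply: is_derive_unique; auto_derive; first by repeat split.
    change (fun x => rho x) with rho; change (fun x => Derive c x) with (Derive c).
    by rewrite /z; ring.
  have qE' := reaction_fluid_state _ _ _ Htau1 Hw (rho x, c x) (Fs x).
  rewrite DY -/q (qE' : q (rho x) (c x) = _) /reac in Hq.
  (* The derivative of [H] is [- c' / rho] times the left side of the reaction equation, once [P] is
     replaced by [pr x + delta * rho x * z x * z x]. *)
  have -> : 0 = - (z x * / rho x) * 0 by ring.
  rewrite -{1}Hq /H; auto_derive.
    by repeat split => //; [exact: Hw|lra].
  change (fun x => c x) with c; change (fun x => pr x) with pr; change (fun x => w x) with w.
  change (fun x => rho x) with rho; change (fun x => z x) with (Derive c).
  rewrite (is_derive_unique pr x _ (Dpr x)) -KP -(Kc x) /z /pr /press /=.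
  rewrite -/w; move: V; rewrite /Rminus; set v := / rho x + - _ => V.
  set L := ln _; field; lra.
have lnP s : fluid_state tau1 s -> 0 < press tau1 s.1 s.2 by case=> ? [? ?]; exact: press_pos.
have Hlim (F : (R -> Prop) -> Prop) (FF : Filter F) s : fluid_state tau1 s ->
    press tau1 s.1 s.2 = P ->
    filterlim rho F (locally s.1) -> filterlim c F (locally s.2) ->
    filterlim H F (locally (s.2 * (tau1 * P - ln P - 1) + w s.2 + ln P + 1)).
  move=> Hs HP Fr Fc; have [Hr [Hv Hc]] := Hs; have V := volume_pos tau1 t0 _ _ Hv Hc.
  have -> : s.2 * (tau1 * P - ln P - 1) + w s.2 + ln P + 1 =
     (1 - s.2) * ln P + w s.2 + P * / s.1 - delta / 2 * ((K - P) * / (delta * s.1)).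
    have -> : P * / s.1 = P * s.2 * tau1 + (1 - s.2).
      by rewrite -HP /press; move: V; set v := / s.1 => V; field; lra.
    by rewrite KP; ring.
  apply: flim_minus; last by apply: flim_mult; [exact: flim_const|exact: zlim].
  apply: flim_plus; last by apply: flim_mult; [exact: flim_const|apply: flim_inv => //; lra].
  apply: flim_plus.
    apply: flim_mult; first by apply: flim_minus => //; exact: flim_const.
    rewrite -HP; apply: flim_comp; first exact: press_flim.
    by apply: ex_derive_continuous; auto_derive; exact: lnP.
  by apply: flim_comp => //; apply: ex_derive_continuous; exact: Hw.
have L1 := is_lim_constant H (H 0) m_infty _ (constant_of_derive0 H DH).
have L2 := is_lim_constant H (H 0) p_infty _ (constant_of_derive0 H DH).
pose proof (L1 _ (Hlim _ _ s1 F1 erefl r1 c1)) as E1.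
pose proof (L2 _ (Hlim _ _ s2 F2 (esym PE) r2 c2)) as E2.
lra.
Qed.

End WaveEnergy.

Lemma flim_pair {T : Type} (G : (T -> Prop) -> Prop) {FG : Filter G} (u v : T -> R) (a b : R) :
  filterlim u G (locally a) -> filterlim v G (locally b) ->
  filterlim (fun t => (u t, v t)) G (locally (a, b)).
Proof.
move=> Hu Hv P [e He].
pose proof (proj1 (filterlim_locally u a) Hu e) as Hu'.
pose proof (proj1 (filterlim_locally v b) Hv e) as Hv'.
by apply: (@filter_imp2 T G FG _ _ _ Hu' Hv') => t H1 H2; apply: He; split.
Qed.

(** Two successive mean values give the constant [1] instead of the sharp [1 / 2]. A quadratic bound
    at a contact point is what makes the speed of the orbit vanish linearly there. *)
Lemma taylor_upper (J : R -> Prop) (f f1 f2 : R -> R) (a c : R) : connected_set J ->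
  derives_on J f f1 -> derives_on J f1 f2 -> (forall t, J t -> f2 t <= 1) ->
  J a -> J c -> f c - f a - f1 a * (c - a) <= (c - a) ^ 2.
Proof.
move=> cJ H0 H1 H2 Ja Jc.
case: (Rtotal_order a c) => [ac|[<-|ca]]; last first.
- have [t [t1 [Jt t2]]] := MVT_on J f f1 c a cJ H0 Jc Ja ca.
  have ta : t < a by lra.
  have [u [u1 [Ju u2]]] := MVT_on J f1 f2 t a cJ H1 Jt Ja ta.
  have -> : f c - f a - f1 a * (c - a) = (f1 a - f1 t) * (a - c) by nra.
  have := H2 u Ju => L; rewrite u2.
  have : f2 u * (a - t) <= 1 * (a - c) by nra.
  by nra.
- by lra.
- have [t [t1 [Jt t2]]] := MVT_on J f f1 a c cJ H0 Ja Jc ac.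
  have ta : a < t by lra.
  have [u [u1 [Ju u2]]] := MVT_on J f1 f2 a t cJ H1 Ja Jt ta.
  have -> : f c - f a - f1 a * (c - a) = (f1 t - f1 a) * (c - a) by nra.
  have := H2 u Ju => L; rewrite u2.
  have : f2 u * (t - a) <= 1 * (c - a) by nra.
  by nra.
Qed.

(** * Near the critical point *)

Section CriticalPoint.

Variables (W : R -> R -> R) (cs ths : R).
Hypotheses (Hcs : 0 < cs < 1) (HW : generic_transition W cs ths).

Definition dW (k : nat) (c theta : R) : R := Derive_n (fun z => W z theta) k c.

(** Each derivative in [c] costs one order of [ex_diff_n], hence the induction over [k] for all
    [m]. *)
Lemma dW_diff (k m : nat) (c theta : R) : 0 < c < 1 -> ex_diff_n (dW k) m c theta.
Proof.
move=> Hc; elim: k m => [|k IH] m; first exact: (gt_smooth HW).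
by have [_ [_ [_ [+ _]]]] := IH (S m).
Qed.

Lemma dW_continuous (k : nat) (c theta : R) : 0 < c < 1 -> continuity_2d_pt (dW k) c theta.
Proof. by move=> Hc; have [] := dW_diff k 0 c theta Hc. Qed.

Lemma dW_derive (k : nat) (c theta : R) : 0 < c < 1 ->
  is_derive (fun c => dW k c theta) c (dW (S k) c theta).
Proof.
by move=> Hc; apply: Derive_correct; have [_ [+ _]] := dW_diff k 1 c theta Hc.
Qed.

Lemma dW2_neg_below : exists e, 0 < e /\ forall theta, ths - e < theta < ths -> dW 2 cs theta < 0.
Proof.
have D : is_derive (fun theta => dW 2 cs theta) ths (Derive (fun theta => dW 2 cs theta) ths).
  by apply: Derive_correct; have [_ [_ [+ _]]] := dW_diff 2 1 cs ths Hcs.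
have [k [kE kl]] := proj1 (derive_slope _ _ _) D.
have [d Hd] := kl (fun v => 0 < v) (open_gt 0 _ (gt_W_cctheta HW)).
exists d; split; first exact: cond_pos.
move=> th Hth; have := kE th; rewrite {2}/dW (gt_W_cc HW) => E.
have : 0 < k th.
  by apply: Hd; rewrite /ball /= /AbsRing_ball /abs /minus /plus /opp /=; apply: Rabs_def1; lra.
by nra.
Qed.

(** [h] is fixed first, from continuity of [dW 4] and [dW 2] at the critical point; [e] must come
    after it, because the signs of [dW 3] at distance [h] hold at [ths] and persist only nearby. The
    factor [64] is generous: it keeps the box inside [(0, 1)] and makes the height above the tangent
    smaller than [(1 - c) / 12]. *)
Lemma transition_box : exists h e, 0 < h /\ 0 < e /\ 64 * h <= cs /\ 64 * h <= 1 - cs /\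
  (forall c theta, cs - 4 * h <= c <= cs + 4 * h -> ths - e < theta <= ths ->
     0 < dW 4 c theta /\ dW 2 c theta <= 1) /\
  (forall theta, ths - e < theta <= ths -> dW 3 (cs - h) theta < 0 /\ 0 < dW 3 (cs + h) theta) /\
  (forall theta, ths - e < theta <= ths -> theta < ths -> dW 2 cs theta < 0).
Proof.
have H4 : 0 < dW 4 cs ths by exact: (gt_W_cccc HW).
have [d4 Hd4] := dW_continuous 4 cs ths Hcs (mkposreal _ H4).
have [d2 Hd2] := dW_continuous 2 cs ths Hcs (mkposreal 1 Rlt_0_1).
have [e2 [e20 He2]] := dW2_neg_below.
pose d := Rmin d4 d2.
have d0 : 0 < d by apply: Rmin_pos; exact: cond_pos.
have dl4 : d <= d4 by exact: Rmin_l.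
have dl2 : d <= d2 by exact: Rmin_r.
pose h := Rmin (d / 8) (Rmin (cs / 64) ((1 - cs) / 64)).
have h0 : 0 < h by repeat apply: Rmin_pos; lra.
have h1 : h <= d / 8 by exact: Rmin_l.
have h2 : h <= cs / 64 by apply: Rle_trans (Rmin_r _ _) _; exact: Rmin_l.
have h3 : h <= (1 - cs) / 64 by apply: Rle_trans (Rmin_r _ _) _; exact: Rmin_r.
have box c th : cs - 4 * h <= c <= cs + 4 * h -> ths - d < th <= ths ->
    0 < dW 4 c th /\ dW 2 c th <= 1.
  move=> Hc Hth.
  have A (D : R) : d <= D -> Rabs (c - cs) < D /\ Rabs (th - ths) < D.
    by move=> dD; split; apply: Rabs_def1; lra.
  have [A1 A2] := A _ dl4; have [B1 B2] := A _ dl2.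
  have /Rabs_def2 /= := Hd4 c th A1 A2; have /Rabs_def2 /= := Hd2 c th B1 B2.
  by rewrite {2 4}/dW (gt_W_cc HW); lra.
pose J c := cs - 4 * h <= c <= cs + 4 * h.
have cJ : connected_set J by move=> a b t; rewrite /J; lra.
have J01 c : J c -> 0 < c < 1 by rewrite /J; lra.
have D3 : derives_on J (fun c => dW 3 c ths) (fun c => dW 4 c ths).
  by move=> c Jc; apply: dW_derive; exact: J01.
have Z3 : dW 3 cs ths = 0 by exact: (gt_W_ccc HW).
have tt : ths - d < ths <= ths by lra.
have N3 : dW 3 (cs - h) ths < 0.
  have [||| t [_ [Jt Ht]]] := MVT_on J _ _ (cs - h) cs cJ D3; rewrite /J; try lra.
  have [+ _] := box t ths Jt tt; rewrite Z3 in Ht; nra.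
have P3 : 0 < dW 3 (cs + h) ths.
  have [||| t [_ [Jt Ht]]] := MVT_on J _ _ cs (cs + h) cJ D3; rewrite /J; try lra.
  have [+ _] := box t ths Jt tt; rewrite Z3 in Ht; nra.
have N3' : 0 < - dW 3 (cs - h) ths by lra.
have Jm : J (cs - h) by rewrite /J; lra.
have Jp : J (cs + h) by rewrite /J; lra.
have [dm Hdm] := dW_continuous 3 (cs - h) ths (J01 _ Jm) (mkposreal _ N3').
have [dp Hdp] := dW_continuous 3 (cs + h) ths (J01 _ Jp) (mkposreal _ P3).
pose e := Rmin d (Rmin e2 (Rmin dm dp)).
have e0 : 0 < e by repeat apply: Rmin_pos => //; exact: cond_pos.
have ed : e <= d by exact: Rmin_l.
have ee2 : e <= e2 by apply: Rle_trans (Rmin_r _ _) _; exact: Rmin_l.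
have edm : e <= dm by do 2 apply: Rle_trans (Rmin_r _ _) _; exact: Rmin_l.
have edp : e <= dp by do 2 apply: Rle_trans (Rmin_r _ _) _; exact: Rmin_r.
exists h, e; split => //; split => //; split; first lra; split; first lra.
split; first by move=> c th Hc Hth; apply: box => //; lra.
split; last by move=> th Hth tl; apply: He2; lra.
move=> th Hth; split.
  have A : Rabs (cs - h - (cs - h)) < dm by rewrite Rminus_eq_0 Rabs_R0; exact: cond_pos.
  have B : Rabs (th - ths) < dm by apply: Rabs_def1; lra.
  by have /Rabs_def2 /= := Hdm _ _ A B; lra.
have A : Rabs (cs + h - (cs + h)) < dp by rewrite Rminus_eq_0 Rabs_R0; exact: cond_pos.
have B : Rabs (th - ths) < dp by apply: Rabs_def1; lra.
by have /Rabs_def2 /= := Hdp _ _ A B; lra.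
Qed.

End CriticalPoint.

(** * Pressure along the branch and the tangency forced by a connection *)

(** On [(0, 1)] the derivative [tau1 - / t] is negative since [tau1 < 1 < / t]. Hence a tangent
    slope determines its pressure. *)
Lemma chemical_decreasing (tau1 a b : R) : 0 < tau1 < 1 -> 0 < a -> a < b -> b < 1 ->
  tau1 * b - ln b - 1 < tau1 * a - ln a - 1.
Proof.
move=> Ht a0 ab b1.
have cJ : connected_set (fun t => 0 < t < 1) by exact: open_interval_connected.
have D : derives_on (fun t => 0 < t < 1) (fun t => tau1 * t - ln t - 1) (fun t => tau1 - / t).
  by move=> t Ht'; auto_derive; [lra|field; lra].
have [|||t [_ [t1 t2]]] := MVT_on _ _ _ a b cJ D; try lra.
have := inv_gt1 t t1; simpl in t2; nra.
Qed.

(** The points [a] and [b] lie in [(0, 1)] on either side of [ps], where the monotone function [g]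
    vanishes. As [s] is continuous with [s ths = 0], the bracket remains valid near [ths]. *)
Lemma pressure_branch (tau1 ps ths e : R) (s : R -> R) : 0 < tau1 < 1 ->
  is_critical_pressure tau1 ps -> 0 < e -> s ths = 0 ->
  (forall theta, ths - e < theta <= ths ->
     filterlim s (within (fun theta => ths - e < theta <= ths) (locally theta)) (locally (s theta))) ->
  exists e' P, 0 < e' <= e /\ P ths = ps /\ forall theta, ths - e' < theta <= ths ->
    0 < P theta < 1 /\ s theta = - (tau1 * P theta - ln (P theta) - 1) /\
    filterlim P (within (fun theta => ths - e' < theta <= ths) (locally theta)) (locally (P theta)).
Proof.
move=> Ht [Hps gps] e0 s0 sc.
pose g p := tau1 * p - ln p - 1.
pose a := ps / 2; pose b := (1 + ps) / 2.
have ga : 0 < g a by rewrite -gps; apply: chemical_decreasing => //; rewrite /a; lra.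
have gb : g b < 0 by rewrite -gps; apply: chemical_decreasing => //; rewrite /b; lra.
have tt : ths - e < ths <= ths by lra.
have near : within (fun theta => ths - e < theta <= ths) (locally ths)
    (fun theta => - g a < s theta < - g b).
  apply: (sc ths tt (fun v => - g a < v < - g b)); rewrite s0.
  have O : open (fun v => - g a < v < - g b) by apply: open_and; [exact: open_gt|exact: open_lt].
  by apply: O; lra.
have [d Hd] := near.
pose e' := Rmin d e.
have e'0 : 0 < e' by apply: Rmin_pos => //; exact: cond_pos.
have e'e : e' <= e by exact: Rmin_r.
have e'd : e' <= d by exact: Rmin_l.
have sb th : ths - e' < th <= ths -> - g a < s th < - g b.
  move=> Hth; apply: Hd; last lra.
  by rewrite /ball /= /AbsRing_ball /abs /minus /plus /opp /=; apply: Rabs_def1; lra.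
have [P HP] : exists P : R -> R, forall th, ths - e' < th <= ths ->
    a <= P th <= b /\ - (g (P th) + s th) = 0 /\
    filterlim P (within (fun th => ths - e' < th <= ths) (locally th)) (locally (P th)).
  (* The minus sign turns the decreasing [g] into the sign pattern that [implicit_root] expects. *)
  apply: (implicit_root _ _ (fun th p => - (g p + s th))).
  - by rewrite /a /b; lra.
  - move=> th p Hth Hp; apply: (derive_flim _ _ _ (- (tau1 - / p))).
    by rewrite /g; rewrite /a /b in Hp; auto_derive; [lra|field; lra].
  - move=> th p Hth Hp; apply: flim_opp; apply: flim_plus; first exact: flim_const.
    have Hth' : ths - e < th <= ths by lra.
    move=> Q HQ; have [r Hr] := sc th Hth' Q HQ.
    by exists r => t Hb Ht'; apply: Hr => //; lra.
  - by move=> th Hth; have := sb th Hth; lra.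
  - move=> th p1 p2 Hth ap pp pb E1 E2.
    have : g p2 < g p1 by apply: chemical_decreasing => //; rewrite /a /b in ap pb; lra.
    by lra.
exists e', P; split => //; split.
  have tt' : ths - e' < ths <= ths by lra.
  have [Pab [PE _]] := HP ths tt'; rewrite s0 /g in PE.
  have p1 : 0 < P ths < 1 by move: Pab; rewrite /a /b; lra.
  case: (Rtotal_order (P ths) ps) => [l|[//|l]].
    by have := chemical_decreasing tau1 (P ths) ps Ht (proj1 p1) l (proj2 Hps); lra.
  by have := chemical_decreasing tau1 ps (P ths) Ht (proj1 Hps) l (proj2 p1); lra.
move=> th Hth; have [Pab [PE PC]] := HP th Hth; rewrite /g in PE.
by split; [move: Pab; rewrite /a /b; lra|split => //; lra].
Qed.

(** Equal slopes come from [q = 0] and equal heights from [wave_energy]. Pressure below [1] makes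
    volume decrease in [c], so the order of the densities becomes the order of the contact
    points. *)
Lemma maxwell_of_connected (n : nat) (tau1 delta mu lambda : R) (W : R -> R -> R) (theta : R)
    (s1 s2 : state) : 0 < tau1 < 1 -> 0 < delta ->
  (forall c, 0 < c < 1 -> ex_derive (fun c => W c theta) c) ->
  fluid_state tau1 s1 -> fluid_state tau1 s2 -> press tau1 s1.1 s1.2 < 1 ->
  coexist tau1 W theta s1 s2 -> connected n tau1 delta mu lambda W theta s1 s2 ->
  let P := press tau1 s1.1 s1.2 in
  bitangent (fun c => W c theta) (Derive (fun c => W c theta)) s1.2 s2.2 /\
  s1 = state_at tau1 P s1.2 /\ s2 = state_at tau1 P s2.2 /\ 0 < P /\
  Derive (fun c => W c theta) s1.2 = - (tau1 * P - ln P - 1).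
Proof.
move=> Ht Hd Hw F1 F2 P1 [q1 [q2 pp]] [r12 [[rho [c wave]] _]] P.
have t0 := proj1 Ht.
rewrite (reaction_fluid_state _ _ _ Ht Hw s1 F1) /reac in q1; rewrite (reaction_fluid_state _ _ _ Ht Hw s2 F2) /reac in q2.
rewrite (pressure_fluid_state _ _ _ Ht s1 F1) (pressure_fluid_state _ _ _ Ht s2 F2) in pp.
have E := wave_energy n tau1 delta mu lambda W theta Ht Hd Hw rho c s1 s2 wave pp.
rewrite -pp in q2; rewrite /= -/P in E; rewrite -/P in q1 q2 P1.
have [r1 [v1 c1]] := F1; have [r2 [v2 c2]] := F2.
have P0 : 0 < P by exact: press_pos.
have S1 : s1 = state_at tau1 P s1.2 by apply: state_at_press.
have S2 : s2 = state_at tau1 P s2.2 by rewrite /P pp; apply: state_at_press => //; exact: press_pos.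
have Pi := inv_gt1 P (conj P0 P1).
have c12 : s1.2 < s2.2.
  have V1 := volume_above tau1 (/ P) _ Ht c1 Pi; have V2 := volume_above tau1 (/ P) _ Ht c2 Pi.
  move: r12; rewrite S1 S2 /= => r12; case: (Rlt_dec s1.2 s2.2) => // nl; exfalso.
  suff : / (s2.2 * tau1 + (1 - s2.2) / P) <= / (s1.2 * tau1 + (1 - s1.2) / P) by lra.
  by apply: Rinv_le_contravar; rewrite /Rdiv; nra.
split; last by split => //; split => //; split => //; lra.
split => //; split; first lra.
have W1 : Derive (fun c => W c theta) s1.2 = - (tau1 * P - ln P - 1) by lra.
by rewrite W1; lra.
Qed.

Theorem theorem1 (n : nat) (tau1 delta mu lambda : R) (W : R -> R -> R)
    (cs ths ps : R)
    (htau1 : 0 < tau1 < 1) (hdelta : 0 < delta)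
    (hmu : 0 <= mu) (hlambda : 0 <= 2 * mu + lambda)
    (hcs : 0 < cs < 1)
    (hW : generic_transition W cs ths)
    (hps : is_critical_pressure tau1 ps) :
  exists tht : R, tht < ths /\
  exists lo up : R -> state,
    (forall theta, tht < theta <= ths ->
       fluid_state tau1 (lo theta) /\ fluid_state tau1 (up theta)) /\
    continuous_on (fun theta => tht < theta <= ths) lo /\
    continuous_on (fun theta => tht < theta <= ths) up /\
    (forall theta, tht < theta <= ths ->
       coexist tau1 W theta (lo theta) (up theta)) /\
    lo ths = critical_state tau1 cs ps /\
    up ths = critical_state tau1 cs ps /\
    (forall theta, tht < theta < ths ->
       connected n tau1 delta mu lambda W theta (lo theta) (up theta)) /\
    (exists N : state -> Prop,
       locally (critical_state tau1 cs ps) N /\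
       forall theta, tht < theta < ths ->
         N (lo theta) /\ N (up theta) /\
         forall s1 s2 : state,
           N s1 -> N s2 -> fluid_state tau1 s1 -> fluid_state tau1 s2 ->
           coexist tau1 W theta s1 s2 ->
           connected n tau1 delta mu lambda W theta s1 s2 ->
           s1 = lo theta /\ s2 = up theta).
Proof.
have [h [e [h0 [e0 [hl [hr [Hbox [H3 H2]]]]]]]] := transition_box W cs ths hcs hW.
pose J c := cs - 4 * h <= c <= cs + 4 * h.
have cJ : connected_set J by move=> a b t; rewrite /J; lra.
have J01 c : J c -> 0 < c < 1 by rewrite /J; lra.
have Hd k th : derives_on J (fun c => dW W k c th) (fun c => dW W (S k) c th).
  by move=> c Jc; apply: (dW_derive _ _ _ hW); exact: J01.
have Hc k c th : J c -> continuity_2d_pt (dW W k) c th.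
  by move=> Jc; apply: (dW_continuous _ _ _ hW); exact: J01.
have [e1 [He1 [x [y Hxy]]]] := bitangent_branch (dW W) cs ths h e h0 e0 Hd Hc
  (fun c th Jc Dth => proj1 (Hbox c th Jc Dth)) (fun th Dth => proj1 (H3 th Dth))
  (fun th Dth => proj2 (H3 th Dth)) H2 (gt_W_cc hW) (gt_W_ccc hW).
pose s th := dW W 1 (x th) th.
have xJ th : ths - e1 < th <= ths -> J (x th) /\ J (y th).
  by move=> /Hxy [? [? _]]; rewrite /J; lra.
have sC th : ths - e1 < th <= ths ->
    filterlim s (within (fun th => ths - e1 < th <= ths) (locally th)) (locally (s th)).
  move=> Hth; have [_ [_ [_ [_ [xc _]]]]] := Hxy th Hth.
  apply: flim_comp2 => //; last by apply: flim_within; exact: filterlim_id.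
  by apply: Hc; have [] := xJ th Hth.
(* The normalization of [W] at the critical point selects [ps] as the limiting pressure. *)
have s0 : s ths = 0.
  have tt : ths - e1 < ths <= ths by lra.
  have [_ [_ [_ [+ _]]]] := Hxy ths tt => /(_ erefl) [xs _].
  by rewrite /s xs; exact: (gt_W_c hW).
have [e2 [P [He2 [Ps HP]]]] := pressure_branch tau1 ps ths e1 s htau1 hps (proj1 He1) s0 sC.
have De th : ths - e2 < th <= ths -> ths - e1 < th <= ths by lra.
have Dw th c : 0 < c < 1 -> ex_derive (fun c => W c th) c.
  by move=> Hcc; eexists; exact: (dW_derive _ _ _ hW 0%nat).
have crit z : z ths = cs -> state_at tau1 (P ths) (z ths) = critical_state tau1 cs ps.
  by move=> ->; rewrite Ps.
have cont z : (forall th, ths - e2 < th <= ths -> J (z th) /\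
      filterlim z (within (fun th => ths - e1 < th <= ths) (locally th)) (locally (z th))) ->
    continuous_on (fun th => ths - e2 < th <= ths) (fun th => state_at tau1 (P th) (z th)).
  move=> Hz th Hth; have [Jz zc] := Hz th Hth; have [P01 [_ Pc]] := HP th Hth.
  have V := volume_above tau1 (/ P th) (z th) htau1 (J01 _ Jz) (inv_gt1 _ P01).
  have zc' : filterlim z (within (fun th => ths - e2 < th <= ths) (locally th)) (locally (z th)).
    move=> Q HQ; have [r Hr] := zc Q HQ.
    by exists r => t Hb Ht'; apply: Hr => //; lra.
  apply: flim_pair => //; apply: flim_inv; first by rewrite /Rdiv; lra.
  apply: flim_plus; first by apply: flim_mult => //; exact: flim_const.
  apply: flim_mult; first by apply: flim_minus => //; exact: flim_const.
  by apply: flim_inv => //; lra.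
have xyE th : ths - e2 < th <= ths -> dW W 1 (y th) th = s th.
  move=> Hth; have [_ [_ [B [E _]]]] := Hxy th (De th Hth).
  case: (Rlt_dec th ths) => l; first by have [_ [E1 _]] := B l; exact: esym E1.
  have te : th = ths by lra.
  by have [xe ye] := E te; rewrite /s xe ye.
exists (ths - e2); split; first lra.
exists (fun th => state_at tau1 (P th) (x th)), (fun th => state_at tau1 (P th) (y th)).
have fluid z th : ths - e2 < th <= ths -> J z -> fluid_state tau1 (state_at tau1 (P th) z).
  by move=> Hth Jz; apply: fluid_state_at => //; [by have [] := HP th Hth|exact: J01].
have pressP z th : ths - e2 < th <= ths -> J z -> press tau1 (state_at tau1 (P th) z).1 z = P th.
  by move=> Hth Jz; apply: press_state_at; [have [] := HP th Hth; lra|exact: J01].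
split.
  by move=> th Hth; have [Jx Jy] := xJ th (De th Hth); split; exact: fluid.
split.
  apply: cont => th Hth; have [Jx Jy] := xJ th (De th Hth).
  by have [_ [_ [_ [_ [xc _]]]]] := Hxy th (De th Hth).
split.
  apply: cont => th Hth; have [Jx Jy] := xJ th (De th Hth).
  by have [_ [_ [_ [_ [_ yc]]]]] := Hxy th (De th Hth).
split.
  move=> th Hth; have [Jx Jy] := xJ th (De th Hth); have [P01 [sE _]] := HP th Hth.
  rewrite /coexist !(pressure_fluid_state _ _ _ htau1) ?(reaction_fluid_state _ _ _ htau1 (Dw th)); try exact: fluid.
  rewrite /reac !pressP //= -[Derive _ (x th)]/(s th) -[Derive _ (y th)]/(dW W 1 (y th) th) xyE //.
  by split; [lra|split => //; lra].
have tt : ths - e1 < ths <= ths by lra.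
have [_ [_ [_ [+ _]]]] := Hxy ths tt => /(_ erefl) [xs ys].
split; first exact: crit.
split; first exact: crit.
split.
  move=> th Hth'; have Hth : ths - e2 < th <= ths by lra.
  have [Jx Jy] := xJ th (De th Hth); have [P01 [sE _]] := HP th Hth.
  have [x3 [y3 [B _]]] := Hxy th (De th Hth).
  have Bt := B (proj2 Hth'); have [xy [_ e2']] := Bt.
  have Dth : ths - e < th <= ths by lra.
  have in_J c : x th < c < y th -> J c by rewrite /J; lra.
  have T a c : J a -> J c ->
      W c th - W a th - dW W 1 a th * (c - a) <= (c - a) ^ 2.
    apply: (taylor_upper J (fun c => W c th) (fun c => dW W 1 c th) (fun c => dW W 2 c th)) => //.
    - exact: (Hd 0%nat th).
    - by move=> t Jt; exact: (proj2 (Hbox t th Jt Dth)).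
  apply: (connected_of_bitangent n tau1 delta mu lambda W th htau1 hdelta (Dw th) (P th) _ _ (s th)) => //.
  - by have := J01 _ Jx; lra.
  - by have := J01 _ Jy; lra.
  - by move=> k c Hcc; case: k => [//|k]; eexists; exact: (dW_derive _ _ _ hW k).
  - move=> c Hcc.
    apply: (bitangent_above J _ _ _ _ _ cJ (Hd 0%nat th) (Hd 1%nat th) (Hd 2%nat th) (Hd 3%nat th)
      (fun t Jt => proj1 (Hbox t th Jt Dth)) (x th) (y th) c) => //; [exact: in_J|lra|lra].
  - by move=> c Hcc; apply: T => //; exact: in_J.
  (* The tangent at [y th] is the same line as that at [x th], so the Taylor bound at [y th]
     concerns the same height. *)
  - move=> c Hcc; have := T (y th) c Jy (in_J _ Hcc); rewrite xyE // => Ty.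
    by change (W (y th) th - W (x th) th = s th * (y th - x th)) in e2'; nra.
  (* The contact points are within [3 h] of [cs], so the height is at most [(6 h)^2], whereas
     [1 - c >= 61 h] and [h <= 1 / 128]. *)
  - move=> c Hcc; have := T (x th) c Jx (in_J _ Hcc); rewrite -/(s th) => Tx.
    by have : (c - x th) ^ 2 <= (6 * h) ^ 2 by [apply: pow_incr; lra]; nra.
(* One neighbourhood for all [theta]: on [J] common tangents are unique, and on pressures in
   [(0, 1)] the slope determines the pressure. *)
exists (fun st => J st.2 /\ 0 < press tau1 st.1 st.2 < 1).
have Fs : fluid_state tau1 (critical_state tau1 cs ps).
  by apply: (fluid_state_at tau1 ps cs) => //; case: hps.
split.
  have pc : press tau1 (critical_state tau1 cs ps).1 cs = ps.
    by apply: (press_state_at tau1 ps cs) => //; case: hps; lra.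
  have L1 : locally (critical_state tau1 cs ps) (fun st : state => J st.2).
    apply: (continuous_snd (critical_state tau1 cs ps).1 cs J).
    have hp : 0 < 4 * h by lra.
    exists (mkposreal _ hp) => c.
    by rewrite /ball /= /AbsRing_ball /abs /minus /plus /opp /= /J => /Rabs_def2; lra.
  have L2 : locally (critical_state tau1 cs ps) (fun st : state => 0 < press tau1 st.1 st.2 < 1).
    apply: (press_flim tau1 htau1 _ (fst : state -> R) snd (critical_state tau1 cs ps) Fs
      (continuous_fst _ _) (continuous_snd _ _) (fun v => 0 < v < 1)).
    have O : open (fun v => 0 < v < 1) by apply: open_and; [exact: open_gt|exact: open_lt].
    by apply: O; rewrite pc; case: hps.
  exact: filter_and.
move=> th Hth'; have Hth : ths - e2 < th <= ths by lra.
have [Jx Jy] := xJ th (De th Hth); have [P01 [sE _]] := HP th Hth.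
split; first by split => //; rewrite pressP.
split; first by split => //; rewrite pressP.
move=> s1 s2 [J1 p1] [J2 p2] F1 F2 co conn.
have [B [S1 [S2 [P0 W1]]]] := maxwell_of_connected n tau1 delta mu lambda W th s1 s2
   htau1 hdelta (Dw th) F1 F2 (proj2 p1) co conn.
have Dth : ths - e < th <= ths by lra.
have [_ [_ [Bxy _]]] := Hxy th (De th Hth).
have [E1 E2] := bitangent_unique J _ _ _ _ _ cJ (Hd 0%nat th) (Hd 1%nat th) (Hd 2%nat th) (Hd 3%nat th)
  (fun t Jt => proj1 (Hbox t th Jt Dth)) _ _ _ _ J1 J2 Jx Jy B (Bxy (proj2 Hth')).
have PE : press tau1 s1.1 s1.2 = P th.
  have W2 : s th = Derive (fun c => W c th) s1.2 by rewrite E1.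
  rewrite W1 sE in W2; case: (Rtotal_order (press tau1 s1.1 s1.2) (P th)) => [l|[//|l]].
    by have := chemical_decreasing tau1 _ _ htau1 P0 l (proj2 P01); lra.
  by have := chemical_decreasing tau1 _ _ htau1 (proj1 P01) l (proj2 p1); lra.
by rewrite S1 S2 PE E1 E2.
Qed.
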